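(* Let $p$ be a prime, let $S$ be the free pro-$p$ group on the basis $X=\{x_1,\dots,x_d\}$, and let $S_1$ be the closed subgroup of $S$ generated by $x_2,\dots,x_d$. Let $R$ be a closed normal subgroup of $S$ contained in $\Phi(S)=S^p[S,S]$, and suppose that $R$ contains an element $r$ of one of the following types: (i) $r=x_1^\lambda s$, where $0\ne\lambda\in p\mathbb{Z}_p$ and $s\in S_1$; (ii) $r=x_1^\lambda st$, where $\lambda\in p\mathbb{Z}_p\setminus p^k\mathbb{Z}_p$ for some $k\ge 2$, $s\in S_1\cap[S,S]$ and $t\in S^{(k+1,p)}\cap[S,S]$. Then there is no continuous homomorphism $\theta\colon G\to 1+p\mathbb{Z}_p$, where $G=S/R$, such that $(G,\theta)$ is a torsion free Kummerian cyclotomic pro-$p$ pair.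
   Context: The lower $p$-central series of a pro-$p$ group $S$ is defined by $S^{(1,p)}=S$ and $S^{(i+1,p)}=(S^{(i,p)})^p[S,S^{(i,p)}]$ (closed subgroups generated). A cyclotomic pro-$p$ pair $(G,\theta)$ consists of a pro-$p$ group $G$ and a continuous homomorphism $\theta\colon G\to 1+p\mathbb{Z}_p$; it is torsion free if $\mathrm{Im}(\theta)$ is torsion free. $K(G,\theta)$ is the closed subgroup of $G$ generated by all $h^{-\theta(g)}ghg^{-1}$ with $g\in G$, $h\in\mathrm{Ker}(\theta)$; the pair is Kummerian if $\mathrm{Ker}(\theta)/K(G,\theta)$ is a free abelian pro-$p$ group. Powers $x^\lambda$ for $\lambda\in\mathbb{Z}_p$ are the usual pro-$p$ powers. *)

(* Defs.v *)
From HB Require Import structures.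
From mathcomp Require Import all_boot all_algebra.
From mathcomp Require Import boolp classical_sets functions cardinality topology.

Set Implicit Arguments.
Unset Strict Implicit.
Unset Printing Implicit Defensive.

Import GRing.Theory.

Local Open Scope classical_set_scope.
Local Open Scope group_scope.

HB.mixin Record isTopGroup G of Group G & Topological G := {
  mulg_continuous : continuous (fun z : G * G => z.1 * z.2);
  invg_continuous : continuous (fun x : G => x^-1)
}.

#[short(type="topGroupType")]
HB.structure Definition TopGroup :=
  {G of Group G & Topological G & isTopGroup G}.

Definition subgroup (G : groupType) (H : set G) : Prop :=
  [/\ H 1, forall x y, H x -> H y -> H (x * y) & forall x, H x -> H x^-1].

Definition normal_subgroup (G : groupType) (N : set G) : Prop :=
  subgroup N /\ forall x g, N x -> N (x ^ g).

Definition subg_of (G : topGroupType) (H : set G) of subgroup H : Type :=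
  set_type H.

Section SubgroupType.
Variables (G : topGroupType) (H : set G) (hH : subgroup H).
Local Notation sH := (subg_of hH).

HB.instance Definition _ := Topological.copy sH (set_type H).

Definition subg_val (x : sH) : G := val (x : set_type H).

Lemma subg_valP (x : sH) : H (subg_val x).
Proof. exact: set_mem (valP (x : set_type H)). Qed.

Definition Subg (x : G) (Hx : H x) : sH := exist _ x (mem_set Hx).

Lemma SubgK x (Hx : H x) : subg_val (Subg Hx) = x.
Proof. by []. Qed.

Lemma subg_val_inj : injective subg_val.
Proof. exact: val_inj. Qed.

Definition subg_one : sH := Subg (let: And3 h _ _ := hH in h).
Definition subg_mul (x y : sH) : sH :=
  Subg (let: And3 _ h _ := hH in h _ _ (subg_valP x) (subg_valP y)).
Definition subg_inv (x : sH) : sH :=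
  Subg (let: And3 _ _ h := hH in h _ (subg_valP x)).

Fact subg_mulA : associative subg_mul.
Proof. by move=> x y z; apply: subg_val_inj; exact: mulgA. Qed.
Fact subg_mul1 : left_id subg_one subg_mul.
Proof. by move=> x; apply: subg_val_inj; exact: mul1g. Qed.
Fact subg_mulg1 : right_id subg_one subg_mul.
Proof. by move=> x; apply: subg_val_inj; exact: mulg1. Qed.
Fact subg_mulV : left_inverse subg_one subg_inv subg_mul.
Proof. by move=> x; apply: subg_val_inj; exact: mulVg. Qed.
Fact subg_mulgV : right_inverse subg_one subg_inv subg_mul.
Proof. by move=> x; apply: subg_val_inj; exact: mulgV. Qed.

HB.instance Definition _ := isGroup.Build sH
  subg_mulA subg_mul1 subg_mulg1 subg_mulV subg_mulgV.

Lemma subg_val_continuous : continuous subg_val.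
Proof. exact: (@initial_continuous (set_type H) G set_val). Qed.

Lemma subg_continuous (T : topologicalType) (f : T -> sH) :
  continuous (subg_val \o f) -> continuous f.
Proof.
move=> cf; apply/continuousP => _ [A oA <-].
by move/continuousP : cf => /(_ _ oA).
Qed.

Fact subg_mulg_continuous : continuous (fun z : sH * sH => z.1 * z.2).
Proof.
apply: subg_continuous => z.
apply: (@continuous_comp _ _ _ (fun z : sH * sH => (subg_val z.1, subg_val z.2))
  (fun w : G * G => w.1 * w.2)); last exact: mulg_continuous.
apply: cvg_pair => /=.
  by apply: (@continuous_comp _ _ _ fst subg_val);
    [exact: cvg_fst | exact: subg_val_continuous].
by apply: (@continuous_comp _ _ _ snd subg_val);
  [exact: cvg_snd | exact: subg_val_continuous].
Qed.

Fact subg_invg_continuous : continuous (fun x : sH => x^-1).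
Proof.
apply: subg_continuous => x.
apply: (@continuous_comp _ _ _ subg_val (fun y : G => y^-1)).
  exact: subg_val_continuous.
exact: invg_continuous.
Qed.

HB.instance Definition _ :=
  isTopGroup.Build sH subg_mulg_continuous subg_invg_continuous.

End SubgroupType.

Section QuotientRel.
Variables (G : topGroupType) (N : set G) (hN : normal_subgroup N).

Definition coset_rel : rel G := fun x y => `[< N (x^-1 * y) >].

Fact coset_rel_refl : reflexive coset_rel.
Proof. by move=> x; apply/asboolP; rewrite mulVg; case: hN => -[]. Qed.

Fact coset_rel_sym : symmetric coset_rel.
Proof.
have imp x y : coset_rel x y -> coset_rel y x.
  case: hN => -[_ _ NV] _ /asboolP /NV Nxy; apply/asboolP.
  by rewrite invgM invgK in Nxy.
by move=> x y; apply/idP/idP; exact: imp.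
Qed.

Fact coset_rel_trans : transitive coset_rel.
Proof.
case: hN => -[_ NM _] _ y x z /asboolP Nxy /asboolP Nyz; apply/asboolP.
by have := NM _ _ Nxy Nyz; rewrite mulgA -(mulgA x^-1) mulgV mulg1.
Qed.

Canonical coset_equiv :=
  EquivRel coset_rel coset_rel_refl coset_rel_sym coset_rel_trans.

Local Open Scope quotient_scope.

Definition quotg : Type := quotient_topology {eq_quot coset_equiv}.

HB.instance Definition _ :=
  Topological.copy quotg (quotient_topology {eq_quot coset_equiv}).
HB.instance Definition _ :=
  Quotient.copy quotg (quotient_topology {eq_quot coset_equiv}).

Definition quotg_pi (x : G) : quotg := \pi_quotg x.

Lemma quotg_piP x y : quotg_pi x = quotg_pi y <-> N (x^-1 * y).
Proof.
have -> : (quotg_pi x = quotg_pi y) =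
    (\pi_{eq_quot coset_equiv} x = \pi_{eq_quot coset_equiv} y) by [].
by split=> [/eqmodP/asboolP|Nxy] //; apply/eqmodP/asboolP.
Qed.

Lemma quotg_reprK (a : quotg) : quotg_pi (repr a) = a.
Proof. exact: reprK. Qed.

Lemma quotg_pi_surj (a : quotg) : exists x, a = quotg_pi x.
Proof. by exists (repr a); rewrite quotg_reprK. Qed.

Definition quotg_mul (a b : quotg) : quotg := quotg_pi (repr a * repr b).
Definition quotg_inv (a : quotg) : quotg := quotg_pi (repr a)^-1.

Lemma quotg_mulE x y : quotg_mul (quotg_pi x) (quotg_pi y) = quotg_pi (x * y).
Proof.
case: (hN) => -[_ NM _] NJ; apply/quotg_piP.
set x' := repr _; set y' := repr _.
have Nx : N (x'^-1 * x) by apply/quotg_piP; exact: quotg_reprK.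
have Ny : N (y'^-1 * y) by apply/quotg_piP; exact: quotg_reprK.
suff -> : (x' * y')^-1 * (x * y) = ((x'^-1 * x) ^ y') * (y'^-1 * y).
  by apply: NM => //; exact: NJ.
by rewrite /conjg invgM !mulgA mulgK.
Qed.

Lemma quotg_invE x : quotg_inv (quotg_pi x) = quotg_pi x^-1.
Proof.
case: (hN) => -[_ NM NV] NJ; apply/quotg_piP.
set x' := repr _; rewrite invgK.
have Nx : N (x'^-1 * x) by apply/quotg_piP; exact: quotg_reprK.
suff -> : x' * x^-1 = ((x'^-1 * x) ^ x'^-1)^-1 by apply: NV; exact: NJ.
by rewrite /conjg !invgM !invgK !mulgA mulgK.
Qed.

Fact quotg_mulA : associative quotg_mul.
Proof.
move=> a b c; have [x ->] := quotg_pi_surj a; have [y ->] := quotg_pi_surj b.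
by have [z ->] := quotg_pi_surj c; rewrite !quotg_mulE mulgA.
Qed.
Fact quotg_mul1 : left_id (quotg_pi 1) quotg_mul.
Proof. by move=> a; have [x ->] := quotg_pi_surj a; rewrite quotg_mulE mul1g. Qed.
Fact quotg_mulg1 : right_id (quotg_pi 1) quotg_mul.
Proof. by move=> a; have [x ->] := quotg_pi_surj a; rewrite quotg_mulE mulg1. Qed.
Fact quotg_mulV : left_inverse (quotg_pi 1) quotg_inv quotg_mul.
Proof.
move=> a; have [x ->] := quotg_pi_surj a.
by rewrite quotg_invE quotg_mulE mulVg.
Qed.
Fact quotg_mulgV : right_inverse (quotg_pi 1) quotg_inv quotg_mul.
Proof.
move=> a; have [x ->] := quotg_pi_surj a.
by rewrite quotg_invE quotg_mulE mulgV.
Qed.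

HB.instance Definition _ := isGroup.Build quotg
  quotg_mulA quotg_mul1 quotg_mulg1 quotg_mulV quotg_mulgV.

Lemma quotg_piM : {morph quotg_pi : x y / x * y}.
Proof. by move=> x y; rewrite -quotg_mulE. Qed.

Lemma quotg_piV : {morph quotg_pi : x / x^-1}.
Proof. by move=> x; rewrite -quotg_invE. Qed.

Lemma quotg_pi_continuous : continuous quotg_pi.
Proof. exact: pi_continuous. Qed.

Lemma mulgl_continuous (g : G) : continuous (fun x : G => g * x).
Proof.
move=> x; apply: (@continuous_comp _ _ _ (fun x => (g, x))
  (fun w : G * G => w.1 * w.2)); last exact: mulg_continuous.
by apply: cvg_pair => //=; exact: cvg_cst.
Qed.

Lemma mulgr_continuous (g : G) : continuous (fun x : G => x * g).
Proof.
move=> x; apply: (@continuous_comp _ _ _ (fun x => (x, g))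
  (fun w : G * G => w.1 * w.2)); last exact: mulg_continuous.
by apply: cvg_pair => //=; exact: cvg_cst.
Qed.

Lemma quotg_pi_open (U : set G) : open U -> open (quotg_pi @` U).
Proof.
move=> oU; change (open (quotg_pi @^-1` (quotg_pi @` U))).
suff -> : quotg_pi @^-1` (quotg_pi @` U) =
    \bigcup_(n in N) ((fun x => x * n) @^-1` U).
  apply: bigcup_open => n _.
  by apply: open_comp => // x _; exact: mulgr_continuous.
apply/seteqP; split=> [x [u Uu /esym /quotg_piP Nu]|x [n Nn /= Ux]].
  by exists (x^-1 * u) => //=; rewrite mulgA mulgV mul1g.
by exists (x * n) => //; apply/esym/quotg_piP; rewrite mulgA mulVg mul1g.
Qed.

Lemma nbhs_quotg_pi (x : G) (U : set G) :
  nbhs x U -> nbhs (quotg_pi x) (quotg_pi @` U).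
Proof.
rewrite nbhsE => -[V [oV Vx] VU].
apply: (@filterS _ _ _ (quotg_pi @` V)); first exact: image_subset.
by apply: open_nbhs_nbhs; split; [exact: quotg_pi_open | exists x].
Qed.

Fact quotg_mulg_continuous : continuous (fun z : quotg * quotg => z.1 * z.2).
Proof.
move=> [a b]; have [x ->] := quotg_pi_surj a; have [y ->] := quotg_pi_surj b.
move=> A /=; rewrite -quotg_piM => /quotg_pi_continuous nA.
have [[U V] /= [nU nV] UV] := @mulg_continuous G (x, y) _ nA.
exists (quotg_pi @` U, quotg_pi @` V).
  by split; exact: nbhs_quotg_pi.
move=> [_ _] /= [[u Uu <-] [v Vv <-]]; rewrite -quotg_piM.
exact: (UV (u, v)).
Qed.

Fact quotg_invg_continuous : continuous (fun a : quotg => a^-1).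
Proof.
move=> a; have [x ->] := quotg_pi_surj a.
move=> A /=; rewrite -quotg_piV => /quotg_pi_continuous nA.
have /nbhs_quotg_pi := @invg_continuous G x _ nA.
apply: filterS => _ [u Au <-].
by rewrite /preimage /= -quotg_piV.
Qed.

HB.instance Definition _ :=
  isTopGroup.Build quotg quotg_mulg_continuous quotg_invg_continuous.

End QuotientRel.

(* The ring Z_p as the inverse limit of the rings Z/p^(n+1)Z; the index is
   shifted because 'Z_1 is not the zero ring. *)
Section Padic.
Variable p : nat.

Record padic := Padic {
  padic_res :> forall n, 'Z_(p ^ n.+1);
  padic_compat : forall n, inZp (padic_res n.+1) = padic_res n
}.

HB.instance Definition _ := gen_eqMixin padic.
HB.instance Definition _ := gen_choiceMixin padic.

Lemma padic_eqP (a b : padic) : (forall n, a n = b n) -> a = b.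
Proof.
case: a b => [a ca] [b cb] /= ab.
have {}ab : a = b by apply: functional_extensionality_dep.
by subst b; congr Padic; exact: Prop_irrelevance.
Qed.

Let tr n := (Zp_trunc (p ^ n.+1)).+2.

Let tr_dvd n : tr n %| tr n.+1.
Proof.
rewrite /tr; case: p => [|[|q]]; first by rewrite !exp0n.
  by rewrite !exp1n.
by rewrite !Zp_cast ?ltn_exp2l ?(@ltn_exp2l _ 0) // dvdn_exp2l.
Qed.

Let red n (m : nat) : inZp (inZp m : 'Z_(p ^ n.+2)) = inZp m :> 'Z_(p ^ n.+1).
Proof. by apply: val_inj => /=; exact: modn_dvdm (tr_dvd n). Qed.

Let resE n (m : 'Z_(p ^ n.+1)) : inZp m = m.
Proof. exact: valZpK. Qed.

Let redD n (x y : 'Z_(p ^ n.+2)) :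
  inZp (x + y)%R = (inZp x + inZp y)%R :> 'Z_(p ^ n.+1).
Proof. by rewrite red; apply: val_inj; rewrite /= modnDm. Qed.

Let redM n (x y : 'Z_(p ^ n.+2)) :
  inZp (x * y)%R = (inZp x * inZp y)%R :> 'Z_(p ^ n.+1).
Proof. by rewrite red; apply: val_inj; rewrite /= modnMm. Qed.

Let red1 n : inZp (1%R : 'Z_(p ^ n.+2)) = 1%R :> 'Z_(p ^ n.+1).
Proof. by rewrite red. Qed.

Let red0 n : inZp (0%R : 'Z_(p ^ n.+2)) = 0%R :> 'Z_(p ^ n.+1).
Proof. by apply: val_inj; rewrite /= mod0n. Qed.

Let redN n (x : 'Z_(p ^ n.+2)) :
  inZp (- x)%R = (- inZp x)%R :> 'Z_(p ^ n.+1).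
Proof. by apply/eqP; rewrite -addr_eq0 -redD addNr red0. Qed.

Definition padic0 : padic := @Padic (fun=> 0%R) red0.
Definition padic1 : padic := @Padic (fun=> 1%R) red1.
Program Definition padicN (a : padic) : padic :=
  @Padic (fun n => - a n)%R _.
Next Obligation. by move=> a n; rewrite redN padic_compat. Qed.
Program Definition padicD (a b : padic) : padic :=
  @Padic (fun n => a n + b n)%R _.
Next Obligation. by move=> a b n; rewrite redD !padic_compat. Qed.
Program Definition padicM (a b : padic) : padic :=
  @Padic (fun n => a n * b n)%R _.
Next Obligation. by move=> a b n; rewrite redM !padic_compat. Qed.

Fact padicDA : associative padicD.
Proof. by move=> a b c; apply: padic_eqP => n; exact: addrA. Qed.
Fact padicDC : commutative padicD.
Proof. by move=> a b; apply: padic_eqP => n; exact: addrC. Qed.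
Fact padic0D : left_id padic0 padicD.
Proof. by move=> a; apply: padic_eqP => n; exact: add0r. Qed.
Fact padicND : left_inverse padic0 padicN padicD.
Proof. by move=> a; apply: padic_eqP => n; exact: addNr. Qed.
HB.instance Definition _ :=
  GRing.isZmodule.Build padic padicDA padicDC padic0D padicND.

Fact padicMA : associative padicM.
Proof. by move=> a b c; apply: padic_eqP => n; exact: mulrA. Qed.
Fact padicMC : commutative padicM.
Proof. by move=> a b; apply: padic_eqP => n; exact: mulrC. Qed.
Fact padic1M : left_id padic1 padicM.
Proof. by move=> a; apply: padic_eqP => n; exact: mul1r. Qed.
Fact padicMDl : left_distributive padicM padicD.
Proof. by move=> a b c; apply: padic_eqP => n; exact: mulrDl. Qed.
Fact padic1_neq0 : padic1 != padic0.
Proof. by apply/eqP => /(congr1 (fun a : padic => a 0%N)). Qed.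
HB.instance Definition _ := GRing.Zmodule_isComNzRing.Build padic
  padicMA padicMC padic1M padicMDl padic1_neq0.

Definition padic_cyl (a : padic) (n : nat) : set padic :=
  [set b | forall i, (i <= n)%N -> b i = a i].

HB.instance Definition _ :=
  hasNbhs.Build padic (fun a => filter_from setT (padic_cyl a)).

Fact padic_nbhs_filter (a : padic) : ProperFilter (nbhs a).
Proof.
apply: filter_from_proper; last by move=> n _; exists a.
apply: filter_from_filter; first by exists 0%N.
move=> m n _ _; exists (maxn m n) => // b ab.
by split=> i im; apply: ab; rewrite leq_max im ?orbT.
Qed.
Fact padic_nbhs_singleton (a : padic) (A : set padic) : nbhs a A -> A a.
Proof. by case=> n _; apply. Qed.
Fact padic_nbhs_nbhs (a : padic) (A : set padic) :
  nbhs a A -> nbhs a (nbhs^~ A).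
Proof.
case=> n _ nA; exists n => // b ab; exists n => // c bc.
by apply: nA => i iN; rewrite bc // ab.
Qed.
HB.instance Definition _ := Nbhs_isNbhsTopological.Build padic
  padic_nbhs_filter padic_nbhs_singleton padic_nbhs_nbhs.

Definition padic_ideal (k : nat) : set padic :=
  [set a | exists b : padic, a = (p%:R ^+ k * b)%R].

End Padic.

Section ClosedSubgroups.
Variable G : topGroupType.

Definition closed_gen (A : set G) : set G :=
  smallest [set H | subgroup H /\ closed H] A.

(* The closed subgroup A^p [G, A]. *)
Definition pow_comm (p : nat) (A : set G) : set G :=
  closed_gen ([set x ^+ p | x in A] `|`
    [set z | exists g x, A x /\ z = [~ g, x]]).

Definition frattini_p (p : nat) : set G := pow_comm p setT.

(* G^(i,p) for i >= 1; the value at i = 0 is irrelevant. *)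
Definition lower_pcentral (p i : nat) : set G := iter i.-1 (pow_comm p) setT.

Definition derived_closed : set G :=
  closed_gen [set z | exists g x : G, z = [~ g, x]].

End ClosedSubgroups.
Arguments frattini_p G p : clear implicits.
Arguments lower_pcentral G p i : clear implicits.
Arguments derived_closed G : clear implicits.

Definition profinite (G : topGroupType) : Prop :=
  [/\ compact [set: G], hausdorff_space G & totally_disconnected [set: G]].

Definition pro_p (p : nat) (G : topGroupType) : Prop :=
  profinite G /\
  forall U : set G, normal_subgroup U -> open U ->
    exists k, (range (fun g : G => [set g * u | u in U]) #= `I_(p ^ k))%card.

Definition abelian_pro_p (p : nat) (G : topGroupType) : Prop :=
  pro_p p G /\ forall x y : G, x * y = y * x.

(* The residues of a p-adic integer l are natural numbers converging to l, so
   that x ^ l is the limit of the powers of x by these residues; the default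
   value 1 is never used when G is a pro-p group. *)
Definition ppow (p : nat) (G : topGroupType) (x : G) (l : padic p) : G :=
  xget 1 [set y : G | (x ^+ (l n : nat)) @[n --> \oo] --> y].

Definition converges_to1 (I : Type) (G : topGroupType) (x : I -> G) : Prop :=
  forall U : set G, nbhs 1 U -> finite_set [set i | ~ U (x i)].

Definition continuous_hom (G H : topGroupType) (f : G -> H) : Prop :=
  continuous f /\ {morph f : x y / x * y}.

(* The universal property is restricted to families converging to 1, the usual
   convention for pro-p groups on infinite bases; for finite I
   every family converges to 1. *)
Definition free_on (C : topGroupType -> Prop) (F : topGroupType)
    (I : Type) (x : I -> F) : Prop :=
  [/\ C F, converges_to1 x &
    forall (B : topGroupType) (y : I -> B), C B -> converges_to1 y ->
      exists! f : F -> B, continuous_hom f /\ (forall i, f (x i) = y i)].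

Definition free_pro_p (p : nat) (F : topGroupType) (I : Type) (x : I -> F) :=
  free_on (pro_p p) x.

Definition free_abelian_pro_p (p : nat) (A : topGroupType) : Prop :=
  exists (I : Type) (x : I -> A), free_on (abelian_pro_p p) x.

(* A homomorphism to the multiplicative group 1 + p Z_p is encoded as a map to
   the ring Z_p; the last field places its image in 1 + p Z_p. *)
Record cyclotomic_pair (p : nat) (G : topGroupType) := CyclotomicPair {
  theta :> G -> padic p;
  cyclo_pro_p : pro_p p G;
  cyclo_continuous : continuous theta;
  cyclo_theta1 : theta 1 = 1%R;
  cyclo_thetaM : forall g h, theta (g * h) = (theta g * theta h)%R;
  cyclo_1p : forall g, padic_ideal 1 (theta g - 1)%R
}.

Definition torsion_free_pair (p : nat) (G : topGroupType)
    (th : cyclotomic_pair p G) : Prop :=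
  forall (g : G) (n : nat), (0 < n)%N -> (th g ^+ n = 1)%R -> th g = 1%R.

Section Kummerian.
Variables (p : nat) (G : topGroupType) (th : cyclotomic_pair p G).

Definition cyclo_ker : set G := [set g | th g = 1%R].

Definition cyclo_K : set G :=
  closed_gen [set z | exists g h : G, cyclo_ker h /\
                        z = ppow h (- th g)%R * g * h * g^-1].

Lemma cyclo_ker_subgroup : subgroup cyclo_ker.
Proof.
split=> [|x y|x]; rewrite /cyclo_ker /=; first exact: cyclo_theta1.
  by move=> x1 y1; rewrite cyclo_thetaM x1 y1 mulr1.
by move=> x1; rewrite -(cyclo_theta1 th) -(mulVg x) cyclo_thetaM x1 mulr1.
Qed.

Definition cyclo_kerg : topGroupType := subg_of cyclo_ker_subgroup.

Lemma conjg_continuous (g : G) : continuous (fun x : G => x ^ g).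
Proof.
move=> x; apply: (@continuous_comp _ _ _ (fun x => x * g) (fun y => g^-1 * y)).
  exact: mulgr_continuous.
exact: mulgl_continuous.
Qed.

Lemma ppow_conj (x g : G) (l : padic p) : ppow x l ^ g = ppow (x ^ g) l.
Proof.
have hG : hausdorff_space G by case: (cyclo_pro_p th) => -[].
have conjcvg (z h y : G) :
    (fun n => z ^+ (l n : nat)) @ \oo --> y ->
    (fun n => (z ^ h) ^+ (l n : nat)) @ \oo --> y ^ h.
  move=> zy; have -> : (fun n => (z ^ h) ^+ (l n : nat)) =
      (fun x => x ^ h) \o (fun n => z ^+ (l n : nat)).
    by apply: funext => n /=; rewrite conjXg.
  exact: (cvg_comp _ _ zy (@conjg_continuous h y)).
rewrite /ppow; case: xgetP => [y _ xy|nx]; case: xgetP => [z _ xz|nz].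
- exact: (cvg_unique hG (conjcvg _ _ _ xy) xz).
- by case: (nz (y ^ g)); exact: conjcvg.
- case: (nx (z ^ g^-1)).
  by have := conjcvg _ g^-1 _ xz; rewrite /= -conjgM mulgV conjg1.
- by rewrite conj1g.
Qed.

Lemma closed_gen_subgroup (A : set G) : subgroup (closed_gen A).
Proof.
split=> [H [[[H1 _ _] _] _] //|x y Ax Ay H hH|x Ax H hH]; have [[[_ HM HV] _] _] := hH.
  by apply: HM; [exact: (Ax H hH) | exact: (Ay H hH)].
by apply: HV; exact: (Ax H hH).
Qed.

Lemma cyclo_K_normal : normal_subgroup cyclo_K.
Proof.
split; first exact: closed_gen_subgroup.
move=> x g Kx; have [K1 KM KV] := closed_gen_subgroup
  [set z | exists g h : G, cyclo_ker h /\
     z = ppow h (- th g)%R * g * h * g^-1].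
apply: (Kx [set x | cyclo_K (x ^ g)]); split; first split.
- split=> [|a b|a] /=; rewrite ?conj1g ?conjMg ?conjVg //.
    exact: KM.
  exact: KV.
- apply: (@closed_comp _ _ (fun x : G => x ^ g)).
    by move=> a _; exact: conjg_continuous.
  by apply: closed_bigI => H [[_ cH] _].
- move=> _ [a [h [h1 ->]]] /=; apply: sub_gen_smallest.
  exists (a ^ g), (h ^ g); have thJ b : th (b ^ g) = th b.
    by rewrite /conjg !cyclo_thetaM mulrCA -cyclo_thetaM mulVg cyclo_theta1 mulr1.
  by rewrite /cyclo_ker /= !thJ; split => //; rewrite !conjMg conjVg ppow_conj.
Qed.

(* K(G, theta) is contained in Ker(theta), so this preimage is K(G, theta)
   viewed inside the topological group Ker(theta). *)
Definition cyclo_K_in_ker : set cyclo_kerg :=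
  @subg_val _ _ cyclo_ker_subgroup @^-1` cyclo_K.

Lemma cyclo_K_in_ker_normal : normal_subgroup cyclo_K_in_ker.
Proof.
have [[K1 KM KV] KJ] := cyclo_K_normal.
split=> [|x g Kx]; last exact: (KJ (subg_val x) (subg_val g)).
by split=> [|x y|x]; [exact: K1 | exact: KM | exact: KV].
Qed.

Definition kummerian : Prop :=
  free_abelian_pro_p p (quotg cyclo_K_in_ker_normal).

End Kummerian.

(* Main.v *)
From HB Require Import structures.
From mathcomp Require Import fingroup cyclic.
Require Import Defs.
From mathcomp Require Import all_boot all_algebra.
From mathcomp Require Import boolp classical_sets functions cardinality topology.
From mathcomp Require Import ring.

Set Implicit Arguments.
Unset Strict Implicit.
Unset Printing Implicit Defensive.

Import GRing.Theory.

Local Open Scope classical_set_scope.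
Local Open Scope group_scope.

(** If theta makes G = S/R a torsion free Kummerian pair, then up to a fixed
unit factor every homomorphism G -> F_p lifts to a continuous cocycle
G -> Z_p(theta): on Ker(theta) the lift comes from the freeness of
Ker(theta)/K, and it extends to G because Im(theta) is procyclic.  Since R lies
in Phi(S), the homomorphisms dual to the basis lift in this way, and the
determinant of the values of the lifts on the basis is a unit, so a combination
c of them satisfies c(x_1) = D with D a unit, c(x_i) = 0 for i > 1 and c(R) = 0.
In case (i), c(x_1^lambda) = 0, and since powers of x_1 commute with x_1 this
forces theta(x_1^lambda) = 1.  In case (ii) this holds because s and t lie in
[S,S].  By torsion freeness theta(x_1) = 1, whence c(x_1^lambda) = lambda D.
This contradicts lambda <> 0 in case (i), and in case (ii) it contradicts
c(S^(k+1,p)) <= p^k Z_p. *)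

(** * Open normal subgroups of profinite groups *)

(** The main obstacle is integrality. A cocycle on G is determined by its restriction to Ker(theta)
    and its value at one g0 whose theta-value topologically generates the image, but recovering it
    means dividing by theta(g0) - 1, which lies in p Z_p. That the division is possible can be
    checked directly only on Ker(theta) and at g0; the congruence expressing it is closed and stable
    under products, so procyclicity spreads it to G. Only p^m is divided out of theta(g0) - 1 = p^m
    u, and this is the origin of the fixed unit factor u. For p = 2 the group 1 + p Z_p contains -1
    and is not procyclic; torsion freeness allows working with theta^p, whose values lie in 1 + p^2
    Z_p. Cocycles constrain r because those coming from S/R vanish on R, and because expanding c(xy)
    = c(yx) for commuting x, y gives (theta(x) - 1) c(y) = (theta(y) - 1) c(x). As [ppow] is a
    chosen limit with a default value, convergence has to be proved, which requires small open
    normal subgroups. *)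

Lemma clopen_avoid_compact (T : topologicalType) (x : T) (K : set T) :
  compact K ->
  (forall y, K y -> exists U : set T, [/\ clopen U, U x & ~ U y]) ->
  exists U : set T, [/\ clopen U, U x & U `<=` ~` K].
Proof.
move=> /compact_near_coveringP cK sepK.
(* Clopen neighbourhoods of [x] are stable under intersection, so the near-covering form of
   compactness turns pointwise separation into separation from all of [K]. *)
pose F := filter_from [set D : set T | D x /\ clopen D] id.
have FF : Filter F.
  apply: filter_from_filter; first by exists setT; split => //; exact: clopenT.
  by move=> A B [? ?] [? ?]; exists (A `&` B) => //; split=> //; exact: clopenI.
have PF : ProperFilter F by apply: filter_from_proper => // ? [? _]; exists x.
have [] := cK _ _ setC (powerset_filter_from_filter PF).
  move=> y /sepK [C [[oC cC] Cx Cy]].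
  exists (~` C, [set U | U `<=` C]); first split.
  - by apply: open_nbhs_nbhs; split => //; exact: closed_openC.
  - apply/near_powerset_filter_fromP; first by move=> ? ?; exact: subset_trans.
    by exists C => //; exists C.
  - by case=> i j [/= Ci jC] /jC.
move=> D [DF _ [C DC]] /(_ _ DC) KC.
have [U [Ux cU] UC] := DF _ DC.
by exists U; split => // u /UC Cu Ku; exact: (KC u Ku).
Qed.

(** If [B] is nonempty and clopen in the quasi-component [Q], normality gives a neighbourhood [V] of
    [B] whose closure misses the rest of [Q]. Its boundary is compact and disjoint from [Q], so some
    clopen [E] around [x] avoids it, and [E] meets the interior of [V] in a clopen set. That set or
    its complement in [E] contains [x], hence all of [Q]. *)
Lemma quasi_component_connected (T : topologicalType) (x : T) :
  compact [set: T] -> hausdorff_space T ->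
  connected [set y | forall U : set T, clopen U -> U x -> U y].
Proof.
move=> cT hT; set Q := [set y | _].
have cQ : closed Q.
  have -> : Q = \bigcap_(U in [set U : set T | clopen U /\ U x]) U.
    by apply/seteqP; split=> y Qy U; [case; exact: Qy | move=> cU Ux; apply: Qy].
  by apply: closed_bigI => U [[]].
move=> B [b Bb] [C oC BC] [D cD BD].
have clB : closed B by rewrite BD; exact: closedI.
have oB' : open (~` (Q `\` C)).
  by apply: closed_openC; rewrite setDE; apply: closedI => //; exact: open_closedC.
have BB' : set_nbhs B (~` (Q `\` C)).
  move=> y By; apply: open_nbhs_nbhs; split => //.
  by move=> [_]; apply; move: By; rewrite BC => -[].
have [V BV VB'] := compact_normal hT cT clB BB'.
pose K := closure V `\` V^°.
have cK : compact K.
  apply: (subclosed_compact _ cT) => //.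
  by apply: closedI; [exact: closed_closure | apply: open_closedC; exact: open_interior].
have QK y : Q y -> ~ K y.
  move=> Qy [/VB' clVy nVy]; apply: nVy; apply: BV; rewrite BC; split => //.
  by apply: contrapT => nC; apply: clVy.
have [|E [[oE cE] Ex EK]] := @clopen_avoid_compact _ x K cK.
  move=> y Ky; apply: contrapT => nU; apply: (QK y) => // U cU Ux.
  by apply: contrapT => nUy; apply: nU; exists U.
have EVo : clopen (E `&` V^°).
  split; first by apply: openI => //; exact: open_interior.
  have -> : E `&` V^° = E `&` closure V.
    apply/seteqP; split=> y [Ey Vy]; split => //.
      by apply: subset_closure; exact: interior_subset.
    by apply: contrapT => nV; exact: (EK y).
  by apply: closedI => //; exact: closed_closure.
have [Vx|nVx] := pselect (V^° x).
  rewrite BC; apply/setIidPl => y Qy; apply: contrapT => nCy.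
  have [_ /interior_subset/subset_closure/VB'] := Qy _ EVo (conj Ex Vx).
  exact.
have Qb : Q b by move: Bb; rewrite BC => -[].
have cEc : clopen (E `&` ~` (E `&` V^°)) by apply: clopenI => //; exact: clopenC.
have [Eb nEb] := Qb _ cEc (conj Ex (fun h => nVx (proj2 h))).
by case: nEb; split=> //; exact: BV.
Qed.

Lemma compact_zero_dimensional (T : topologicalType) :
  compact [set: T] -> hausdorff_space T -> totally_disconnected [set: T] ->
  zero_dimensional T.
Proof.
move=> cT hT dT x y xy; apply: contrapT => nU.
have : connected_component setT x y.
  apply: (connected_component_max _ _ (quasi_component_connected (x := x) cT hT)) => //.
  by move=> U cU Ux; apply: contrapT => nUy; apply: nU; exists U.
by rewrite dT // => yx; rewrite yx eqxx in xy.
Qed.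

Lemma continuous_mulg (T : topologicalType) (G : topGroupType) (f g : T -> G) :
  continuous f -> continuous g -> continuous (fun z => f z * g z).
Proof.
move=> cf cg z; apply: (@continuous_comp _ _ _ (fun z => (f z, g z))
  (fun w : G * G => w.1 * w.2)); last exact: mulg_continuous.
by apply: cvg_pair; [exact: cf|exact: cg].
Qed.

Lemma subgroup_nbhs1_open (G : topGroupType) (H : set G) :
  subgroup H -> nbhs 1 H -> open H.
Proof.
move=> [_ HM _] H1; rewrite openE => h Hh; change (nbhs h H).
have Hh1 : nbhs (h^-1 * h) H by rewrite mulVg.
apply: (@filterS _ (nbhs h) _ _ _ _ (@mulgl_continuous G h^-1 h H Hh1)) => g Hg.
by have := HM _ _ Hh Hg; rewrite mulgA mulgV mul1g.
Qed.

Lemma profinite_normal_basis (G : topGroupType) (W : set G) :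
  profinite G -> nbhs 1 W ->
  exists U : set G, [/\ normal_subgroup U, open U & U `<=` W].
Proof.
move=> [cG hG dG] W1.
have [C [C1 [oC cC]] CW] :=
  zero_dimensional_cvg hG (compact_zero_dimensional cG hG dG) cG W1.
(* The largest normal subgroup N such that the clopen set C is a union of
   cosets of N; it is open by the tube lemma. *)
pose N := [set g : G | forall a b, C (a * b) <-> C (a * g * b)].
have sN : subgroup N.
  split=> [a b|g h Ng Nh a b|g Ng a b]; first by rewrite mulg1.
    by apply: (iff_trans (Ng a b)); rewrite mulgA; exact: Nh.
  by apply: iff_sym; have := Ng a (g^-1 * b); rewrite !mulgA mulgK.
have nN : normal_subgroup N.
  split=> // g h Ng a b; rewrite /conjg.
  have := Ng (a * h^-1) (h * b); rewrite !mulgA.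
  by rewrite mulgVK.
exists N; split => //; last first.
  by move=> g /(_ 1 1); rewrite !mulg1 mul1g => /iffLR/(_ C1)/CW.
apply: subgroup_nbhs1_open => //.
have cGG : compact ([set: G] `*` [set: G]) by exact: compact_setX.
have cont1 : continuous (fun w : (G * G) * G => w.1.1 * w.1.2).
  by apply: continuous_mulg => w; apply: (@continuous_comp _ _ _ fst);
    [exact: cvg_fst|exact: cvg_fst|exact: cvg_fst|exact: cvg_snd].
have cont2 : continuous (fun w : (G * G) * G => w.1.1 * w.2 * w.1.2).
  apply: continuous_mulg => w.
    apply: continuous_mulg => {}w; last exact: cvg_snd.
    by apply: (@continuous_comp _ _ _ fst); exact: cvg_fst.
  by apply: (@continuous_comp _ _ _ fst); [exact: cvg_fst|exact: cvg_snd].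
move/compact_near_coveringP: cGG => /(_ G (nbhs 1)
  (fun g z => C (z.1 * z.2) <-> C (z.1 * g * z.2)) _) nC.
have : \forall g \near (1 : G), [set: G] `*` [set: G] `<=`
    (fun z => C (z.1 * z.2) <-> C (z.1 * g * z.2)).
  apply: nC => -[a b] _.
  have step (D : set G) : open D -> D (a * b) ->
      \forall w \near ((a, b), 1 : G), D (w.1.1 * w.1.2) /\ D (w.1.1 * w.2 * w.1.2).
    move=> oD Dab; apply: filterI.
      by apply: (cont1 ((a, b), 1)); exact: open_nbhs_nbhs.
    by apply: (cont2 ((a, b), 1)); apply: open_nbhs_nbhs; rewrite /= mulg1.
  (* [C] and its complement are both open, so either truth value persists near ((a, b), 1). *)
  have [Cab|nCab] := pselect (C (a * b)).
    by apply: filterS (step C oC Cab) => w [].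
  by apply: filterS (step _ (closed_openC cC) nCab) => w [].
by apply: filterS => g Pg a b; exact: (Pg (a, b)).
Qed.

(* A map onto 'I_n whose fibres are compatible with multiplication transports
   the group law to 'I_n, where Lagrange's theorem applies. *)
Lemma finite_image_expg (G : groupType) n (e : G -> 'I_n) :
  (forall i, exists g, e g = i) ->
  (forall g g' h h', e g = e g' -> e h = e h' -> e (g * h) = e (g' * h')) ->
  forall x, e (x ^+ n) = e 1.
Proof.
move=> surj eM x.
pose s i := projT1 (cid (surj i)).
have sK i : e (s i) = i by rewrite /s; case: cid.
pose mul i j := e (s i * s j).
have mulE g h : mul (e g) (e h) = e (g * h) by apply: eM; rewrite sK.
have mulA : associative mul.
  by move=> i j k; rewrite -(sK i) -(sK j) -(sK k) !mulE mulgA.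
have mul1 : left_id (e 1) mul by move=> i; rewrite -(sK i) mulE mul1g.
pose inv i := e (s i)^-1.
have mulV : left_inverse (e 1) inv mul.
  by move=> i; rewrite /inv -{2}(sK i) mulE mulVg.
pose gT : finGroupType := HB.pack 'I_n (Finite_isGroup.Build 'I_n mulA mul1 mulV).
have eX m : e (x ^+ m) = (e x : gT) ^+ m.
  elim: m => [|m IH]; first by rewrite !expg0.
  by rewrite !expgS -IH -mulE.
have := @expg_cardG gT [set: gT]%G (e x) (finset.in_setT _).
by rewrite eX cardsT card_ord => ->.
Qed.

Lemma coset_set_eqP (G : groupType) (U : set G) (g h : G) : subgroup U ->
  [set g * u | u in U] = [set h * u | u in U] <-> U (g^-1 * h).
Proof.
move=> [U1 UM UV]; split=> [gh|Ugh].
  have : [set h * u | u in U] (h * 1) by exists 1.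
  by rewrite -gh mulg1 => -[u Uu <-]; rewrite mulKg.
apply/seteqP; split=> _ [u Uu <-].
  exists ((g^-1 * h)^-1 * u); first by apply: UM => //; exact: UV.
  by rewrite invgM invgK mulgA mulgA mulgV mul1g.
exists (g^-1 * h * u); first exact: UM.
by rewrite !mulgA mulgV mul1g.
Qed.

(** The definition of pro-p only counts cosets; numbering them makes Lagrange's theorem available
    for G/U through [finite_image_expg]. *)
Lemma pro_p_expg_open (p : nat) (G : topGroupType) (U : set G) :
  pro_p p G -> normal_subgroup U -> open U ->
  exists k, forall x : G, U (x ^+ (p ^ k)).
Proof.
move=> [_ cardG] nU oU; have [k /card_set_bijP[f fbij]] := cardG U nU oU.
exists k.
have [[U1 UM UV] UJ] := nU.
pose cs (g : G) := [set g * u | u in U].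
have csP g h : cs g = cs h <-> U (g^-1 * h) by exact: coset_set_eqP.
have flt g : (f (cs g) < p ^ k)%N.
  by case: fbij => + _ _; apply; exists g.
pose e g := Ordinal (flt g).
have eP g h : e g = e h <-> U (g^-1 * h).
  rewrite -csP; split=> [/(congr1 val) /= gh|gh]; last first.
    by apply: val_inj => /=; rewrite gh.
  case: fbij => _ finj _; apply: finj => //; apply/mem_set; [by exists g|by exists h].
have esurj i : exists g, e g = i.
  case: fbij => _ _ /(_ i (ltn_ord i)) [_ [g _ <-] fi].
  by exists g; apply: val_inj.
have eM g g' h h' : e g = e g' -> e h = e h' -> e (g * h) = e (g' * h').
  rewrite !eP => Ug Uh.
  have -> : (g * h)^-1 * (g' * h') = (g^-1 * g') ^ h * (h^-1 * h').
    by rewrite /conjg invgM !mulgA mulgK.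
  by apply: UM => //; exact: UJ.
by move=> x; have := finite_image_expg esurj eM x; rewrite eP mulg1 => /UV; rewrite invgK.
Qed.

(** * The ring of p-adic integers *)

Section PadicIdeals.
Variables (p : nat) (p_prime : prime p).
Implicit Types (a b c : padic p) (m n k : nat).
Local Notation ideal := (@padic_ideal p).
Local Open Scope ring_scope.

Let pX_gt0 n : (0 < p ^ n)%N. Proof. by rewrite expn_gt0 prime_gt0. Qed.
Let pX_gt1 n : (1 < p ^ n.+1)%N.
Proof. by rewrite -(exp1n n.+1) ltn_exp2r // prime_gt1. Qed.

Lemma val_inZp_expn n m : (inZp m : 'Z_(p ^ n.+1)) = (m %% p ^ n.+1)%N :> nat.
Proof. by rewrite /= Zp_cast. Qed.

Lemma padic_res_lt a n : (a n < p ^ n.+1)%N.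
Proof. by have := ltn_ord (a n); rewrite [X in (_ < X)%N]Zp_cast. Qed.

Lemma padic_resD a b n : (a + b) n = ((a n + b n) %% p ^ n.+1)%N :> nat.
Proof. by rewrite -val_inZp_expn. Qed.

Lemma padic_resM a b n : (a * b) n = ((a n * b n) %% p ^ n.+1)%N :> nat.
Proof. by rewrite -val_inZp_expn. Qed.

Lemma padic_res_nat m n : (m%:R : padic p) n = (m %% p ^ n.+1)%N :> nat.
Proof.
elim: m => [|m IH]; first by rewrite mod0n.
by rewrite -natr1 padic_resD IH modnDml addn1.
Qed.

Lemma padic_nat_res n (b : 'Z_(p ^ n.+1)) : ((b : nat)%:R : padic p) n = b.
Proof.
by apply: ord_inj; rewrite padic_res_nat modn_small // -[X in (_ < X)%N]Zp_cast.
Qed.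

Lemma padic_res_mod a n m : (n <= m)%N -> (a m %% p ^ n.+1)%N = a n.
Proof.
move=> /subnK <-; elim: (m - n)%N => [|j IH]; first by rewrite modn_small // padic_res_lt.
rewrite -IH -(padic_compat a (j + n)) val_inZp_expn modn_dvdm //.
by rewrite dvdn_exp2l // ltnS leq_addl.
Qed.

Lemma pideal_resP a n : ideal n.+1 a <-> (a n : nat) = 0%N.
Proof.
split=> [[b ->]|an0].
  by rewrite -natrX padic_resM padic_res_nat modnn mul0n mod0n.
have dvd j : (p ^ n.+1 %| a (j + n.+1))%N.
  by rewrite /dvdn padic_res_mod ?an0 // -addSnnS leq_addl.
(* Dividing by p^(n+1) costs n+1 digits, so residue [j] of the quotient is read off from residue
   [j + n.+1] of [a]. *)
pose bs j : 'Z_(p ^ j.+1) := inZp (a (j + n.+1)%N %/ p ^ n.+1).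
have bsE j : (bs j : nat) = ((a (j + n.+1)%N %/ p ^ n.+1) %% p ^ j.+1)%N.
  exact: val_inZp_expn.
have bcompat j : inZp (bs j.+1) = bs j.
  apply: val_inj; rewrite [LHS]val_inZp_expn [RHS]bsE bsE.
  rewrite modn_dvdm ?dvdn_exp2l //.
  rewrite -(padic_res_mod a (leqnSn (j + n.+1))) addSn.
  move: (nat_of_ord (a (j + n.+1).+1)) => A.
  rewrite {1}(divn_eq A (p ^ (j + n.+1).+1)); move: (A %/ _)%N => q.
  by rewrite -addSn expnD mulnA divnMDl // -modnDml modnMl add0n.
exists (Padic bcompat); apply: padic_eqP => j; apply: val_inj.
rewrite -natrX [RHS]padic_resM padic_res_nat modnMml bsE modnMmr mulnC.
by rewrite divnK // padic_res_mod // leq_addr.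
Qed.

Lemma pideal0 a : ideal 0 a.
Proof. by exists a; rewrite expr0 mul1r. Qed.

Lemma pideal_zero n : ideal n 0.
Proof. by exists 0; rewrite mulr0. Qed.

Lemma pidealD n a b : ideal n a -> ideal n b -> ideal n (a + b).
Proof. by move=> [a' ->] [b' ->]; exists (a' + b'); rewrite mulrDr. Qed.

Lemma pidealMl n a b : ideal n b -> ideal n (a * b).
Proof. by move=> [b' ->]; exists (a * b'); rewrite mulrCA. Qed.

Lemma pidealMr n a b : ideal n a -> ideal n (a * b).
Proof. by rewrite mulrC; exact: pidealMl. Qed.

Lemma pidealN n a : ideal n a -> ideal n (- a).
Proof. by rewrite -mulN1r; exact: pidealMl. Qed.

Lemma pidealB n a b : ideal n a -> ideal n b -> ideal n (a - b).
Proof. by move=> Ia Ib; apply: pidealD => //; exact: pidealN. Qed.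

Lemma pidealM m n a b : ideal m a -> ideal n b -> ideal (m + n) (a * b).
Proof. by move=> [a' ->] [b' ->]; exists (a' * b'); rewrite exprD; ring. Qed.

Lemma pideal_le m n a : (m <= n)%N -> ideal n a -> ideal m a.
Proof.
by move=> /subnKC <- [b ->]; exists (p%:R ^+ (n - m) * b); rewrite exprD mulrA.
Qed.

Lemma pideal_pX n : ideal n (p%:R ^+ n).
Proof. by exists 1; rewrite mulr1. Qed.

Lemma pideal_cancel_pX m n a : ideal (m + n) (p%:R ^+ m * a) -> ideal n a.
Proof.
case: n => [|n]; first by move=> _; exact: pideal0.
rewrite addnS => /pideal_resP; rewrite -natrX padic_resM padic_res_nat modnMml.
move=> h; apply/pideal_resP; rewrite -(padic_res_mod a (leq_addl m n)).
move: h; move: (nat_of_ord _) => A /eqP; rewrite -/(dvdn _ _) -addnS expnD.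
by rewrite dvdn_pmul2l // => /eqP.
Qed.

Lemma pideal_sep a : (forall n, ideal n a) -> a = 0.
Proof.
by move=> Ia; apply: padic_eqP => n; apply: val_inj; apply/pideal_resP.
Qed.

Lemma mul_pX_inj m a b : p%:R ^+ m * a = p%:R ^+ m * b -> a = b.
Proof.
move=> ab; apply/eqP; rewrite -subr_eq0; apply/eqP; apply: pideal_sep => n.
by apply: (@pideal_cancel_pX m); rewrite mulrBr ab subrr; exact: pideal_zero.
Qed.

(** Units of Z_p appear throughout as elements outside p Z_p. No p-adic inverse is formed:
    cancelling modulo every p^n suffices. *)
Lemma pideal_cancel_unit n a b : ~ ideal 1 a -> ideal n (a * b) -> ideal n b.
Proof.
move=> na; case: n => [|n]; first by move=> _; exact: pideal0.
move=> /pideal_resP; rewrite padic_resM => /eqP; rewrite -/(dvdn _ _).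
rewrite Gauss_dvdr; last first.
  rewrite coprimeXl // prime_coprime //; apply/negP => pa; apply: na.
  by apply/pideal_resP; rewrite -(padic_res_mod a (leq0n n)) expn1; apply/eqP.
by move=> bn; apply/pideal_resP; move: bn; rewrite /dvdn modn_small ?padic_res_lt // => /eqP.
Qed.

Lemma pideal_valuation a : a <> 0 -> exists v, ideal v a /\ ~ ideal v.+1 a.
Proof.
move=> a0; have [n nIa] : exists n, ~ ideal n a.
  by apply: contrapT => h; apply/a0/pideal_sep => n; apply: contrapT => ?; apply: h; exists n.
elim: n nIa => [|n IH] nIa; first by case: nIa; exact: pideal0.
by have [Ian|/IH//] := pselect (ideal n a); exists n.
Qed.

Lemma pideal_natP n m : reflect (ideal n m%:R) (p ^ n %| m)%N.
Proof.
apply: (iffP idP); case: n => [|n]; rewrite ?expn0 ?dvd1n //.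
- by move=> _; exact: pideal0.
- by move=> /eqP h; apply/pideal_resP; rewrite padic_res_nat.
- by move=> /pideal_resP; rewrite padic_res_nat => /eqP.
Qed.

Lemma pideal1_nat m : ideal 1 m%:R <-> (p %| m)%N.
Proof. by rewrite -[X in (X %| m)%N]expn1; split=> /pideal_natP. Qed.

Lemma pideal_nat_sub a n : ideal n.+1 (a - (a n : nat)%:R).
Proof.
apply/pideal_resP.
have -> : (a - (a n : nat)%:R) n = a n - ((a n : nat)%:R : padic p) n by [].
suff -> : ((a n : nat)%:R : padic p) n = a n by rewrite subrr.
by apply: val_inj; rewrite /= padic_res_nat modn_small // padic_res_lt.
Qed.

End PadicIdeals.

Section PadicTopology.
Variables (p : nat) (p_prime : prime p).
Implicit Types (a b c : padic p) (m n k : nat).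
Local Notation ideal := (@padic_ideal p).
Local Open Scope ring_scope.

Lemma padic_cylE a n b : padic_cyl a n b <-> ideal n.+1 (b - a).
Proof.
rewrite pideal_resP //; split=> [ba|].
  by have -> : (b - a) n = b n - a n by []; rewrite ba // subrr.
have -> : (b - a) n = b n - a n by [].
move=> ba i lin; have ban : b n = a n.
  by apply/eqP; rewrite -subr_eq0; apply/eqP; exact: val_inj.
by apply: val_inj; rewrite /= -(padic_res_mod p_prime b lin) ban padic_res_mod.
Qed.

Lemma nbhs_padicP a (A : set (padic p)) :
  nbhs a A <-> exists n, forall b, ideal n (b - a) -> A b.
Proof.
split=> [[n _ nA]|[n nA]]; first by exists n.+1 => b /padic_cylE /nA.
exists n => // b /padic_cylE ba; apply: nA.
by apply: pideal_le ba.
Qed.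

Lemma pideal_sub_sym n a b : ideal n (a - b) -> ideal n (b - a).
Proof. by move=> /pidealN; rewrite opprB. Qed.

Lemma pideal_sub_trans n a b c : ideal n (a - b) -> ideal n (b - c) -> ideal n (a - c).
Proof. by move=> ab bc; rewrite -(subrKA b); exact: pidealD. Qed.

Lemma padic_continuousP (T : topologicalType) (f : T -> padic p) :
  continuous f <-> forall x n, \forall y \near x, ideal n (f y - f x).
Proof.
split=> [cf x n|cf x A /nbhs_padicP[n nA]].
  have fxn : nbhs (f x) [set b | ideal n (b - f x)] by apply/nbhs_padicP; exists n.
  by apply: (@filterS _ (nbhs x) _ _ _ _ (cf x _ fxn)) => y.
by apply: (@filterS _ (nbhs x) _ _ _ _ (cf x n)) => y /nA.
Qed.

Lemma padic_hausdorff : hausdorff_space (padic p).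
Proof.
move=> a b ab; apply/eqP; rewrite -subr_eq0; apply/eqP; apply: (pideal_sep p_prime) => n.
have [|| c [/= ca cb]] := ab [set c | ideal n (c - a)] [set c | ideal n (c - b)].
- by apply/nbhs_padicP; exists n.
- by apply/nbhs_padicP; exists n.
by apply: pideal_sub_trans cb; exact: pideal_sub_sym.
Qed.

Lemma pideal_coset_clopen n a : clopen [set b | ideal n (b - a)].
Proof.
split.
  rewrite openE => b /= ba; apply/nbhs_padicP; exists n => c cb /=.
  exact: pideal_sub_trans ba.
rewrite -openC openE => b /= nba; apply/nbhs_padicP; exists n => c cb /= ca.
by apply: nba; apply: pideal_sub_trans ca; exact: pideal_sub_sym.
Qed.

Lemma pideal_closed n : closed (ideal n).
Proof.
have [_] := pideal_coset_clopen n 0.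
by congr closed; apply/seteqP; split=> a /=; rewrite subr0.
Qed.

Lemma padic_totally_disconnected : totally_disconnected [set: padic p].
Proof.
apply: zero_dimension_totally_disconnected => a b ab.
have [n nab] : exists n, ~ ideal n (b - a).
  apply: contrapT => h; have /eqP := ab; apply; apply/esym/eqP; rewrite -subr_eq0.
  by apply/eqP/(pideal_sep p_prime) => n; apply: contrapT => ?; apply: h; exists n.
exists [set b | ideal n (b - a)]; split => //; first exact: pideal_coset_clopen.
by rewrite /= subrr; exact: pideal_zero.
Qed.

(** An ultrafilter selects one of the finitely many values of each residue; the selected values are
    compatible and form its limit. *)
Lemma padic_compact : compact [set: padic p].
Proof.
rewrite compact_ultra => F FU _.
have FF : ProperFilter F by apply: ultra_proper.
have Fres n : exists r : 'Z_(p ^ n.+1), F [set a | a n = r].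
  apply: contrapT => h.
  have : F [set a : padic p | forall r : 'Z_(p ^ n.+1), a n <> r].
    apply: filter_forall => r.
    have [Fr|//] := @in_ultra_setVsetC _ F [set a : padic p | a n = r] FU.
    by case: h; exists r.
  by case/filter_ex => a /(_ (a n)).
pose r n := projT1 (cid (Fres n)).
have rP n : F [set a | a n = r n] by rewrite /r; case: cid.
have rcompat n : inZp (r n.+1) = r n.
  have [a [/= a1 a2]] := filter_ex (filterI (rP n.+1) (rP n)).
  by rewrite -a1 -a2 padic_compat.
exists (Padic rcompat); split => // A /nbhs_padicP[n nA].
apply: filterS (rP n) => a /= an; apply: nA.
apply: (@pideal_le _ n n.+1) => //; apply/padic_cylE => i lin.
apply: val_inj; rewrite /= -(padic_res_mod p_prime a lin) an.
by rewrite -(padic_res_mod p_prime (Padic rcompat) lin).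
Qed.

End PadicTopology.

(** * Powers of elements of 1 + p Z_p *)

Section OneUnits.
Variables (p : nat) (p_prime : prime p).
Implicit Types (a b c z : padic p) (m n k : nat).
Local Notation ideal := (@padic_ideal p).
Local Open Scope ring_scope.

(** First-order binomial expansion, the source of the estimates below: the error is divisible by
    z^2, so it has at least twice the valuation of z. *)
Lemma exprD1_mod2 (A : comNzRingType) (z : A) n :
  exists w, (1 + z) ^+ n = 1 + n%:R * z + z ^+ 2 * w.
Proof.
elim: n => [|n [w IH]]; first by exists 0; rewrite expr0; ring.
by exists (w + n%:R + z * w); rewrite exprS IH -natr1; ring.
Qed.

Lemma pideal_one_sub_exp a n m : ideal n (a - 1) -> ideal n (a ^+ m - 1).
Proof. by move=> a1; rewrite subrX1; exact: pidealMr. Qed.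

Lemma pideal_one_sub_coprime_exp a n m : (0 < n)%N -> ~~ (p %| m)%N ->
  ideal n (a - 1) -> ideal n.+1 (a ^+ m - 1) -> ideal n.+1 (a - 1).
Proof.
move=> n0 pm an am; have [w aw] := exprD1_mod2 (a - 1) m.
have Iw : ideal n.+1 ((a - 1) ^+ 2 * w).
  apply: pidealMr; rewrite expr2; apply: pideal_le (pidealM an an).
  by rewrite -addn1 leq_add2l.
have amE : m%:R * (a - 1) = (a ^+ m - 1) - (a - 1) ^+ 2 * w.
  have a1E : 1 + (a - 1) = a by ring.
  by rewrite a1E in aw; rewrite aw; ring.
apply: (pideal_cancel_unit p_prime (a := m%:R)).
  by rewrite pideal1_nat //; apply/negP.
by rewrite amE; exact: pidealB.
Qed.

Lemma pideal_one_sub_expp a n : (0 < n)%N ->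
  ideal n (a - 1) -> ideal n.+1 (a ^+ p - 1).
Proof.
move=> n0 an; have [w aw] := exprD1_mod2 (a - 1) p.
have a1E : 1 + (a - 1) = a by ring.
rewrite a1E in aw; rewrite aw.
have -> : 1 + p%:R * (a - 1) + (a - 1) ^+ 2 * w - 1 =
    (a - 1) ^+ 2 * w + p%:R * (a - 1) by ring.
apply: pidealD.
  apply: pidealMr; rewrite expr2; apply: pideal_le (pidealM an an).
  by rewrite -addn1 leq_add2l.
rewrite -add1n; apply: pidealM => //; have := @pideal_pX p 1; by rewrite expr1.
Qed.

(** The quadratic error lies in p^(2n) Z_p, and 2n >= n+2 requires n >= 2. For n = 1 the element -1
    with p = 2 is a counterexample. *)
Lemma pideal_one_sub_expp_inv a n : (1 < n)%N ->
  ideal n (a - 1) -> ideal n.+2 (a ^+ p - 1) -> ideal n.+1 (a - 1).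
Proof.
move=> n1 an ap; have [w aw] := exprD1_mod2 (a - 1) p.
have a1E : 1 + (a - 1) = a by ring.
rewrite a1E in aw.
apply: (@pideal_cancel_pX _ p_prime 1); rewrite add1n expr1.
have -> : p%:R * (a - 1) = (a ^+ p - 1) - (a - 1) ^+ 2 * w by rewrite aw; ring.
apply: pidealB => //.
apply: pidealMr; rewrite expr2; apply: pideal_le (pidealM an an).
by rewrite -addn2 leq_add2l.
Qed.

Lemma pideal_one_sub_expXp a n m : (0 < n)%N ->
  ideal n (a - 1) -> ideal (n + m) (a ^+ (p ^ m) - 1).
Proof.
move=> n0 an; elim: m => [|m IH]; first by rewrite addn0 expn0 expr1.
rewrite addnS expnSr exprM; apply: pideal_one_sub_expp => //.
by rewrite addn_gt0 n0.
Qed.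

Lemma pideal_one_sub_expXp_inv a n m : (1 < n)%N ->
  ideal n (a - 1) -> ideal (n + m).+1 (a ^+ (p ^ m) - 1) -> ideal n.+1 (a - 1).
Proof.
move=> n1 an; elim: m => [|m IH]; first by rewrite addn0 expn0 expr1.
rewrite addnS expnSr exprM => h; apply: IH.
apply: pideal_one_sub_expp_inv => //; first by rewrite ltn_addr.
by apply: pideal_one_sub_expXp => //; exact: ltnW.
Qed.

(** A Bezout coefficient inverts [a] modulo p. *)
Lemma pideal_mod_solve a b : ~ ideal 1 a -> exists e : nat, ideal 1 (b - e%:R * a).
Proof.
move=> na.
have pa : ~~ (p %| a 0%N)%N.
  apply/negP => pa; apply: na.
  apply/pideal_resP => //; apply/eqP; have := pa.
  rewrite /dvdn modn_small //.
  by have := padic_res_lt p_prime a 0; rewrite [X in (_ < X)%N]expn1.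
have a0 : (0 < a 0%N)%N by rewrite lt0n; apply: contraNneq pa => ->.
have co : gcdn (a 0%N) p = 1%N.
  by apply/eqP; rewrite -/(coprime _ _) coprime_sym prime_coprime.
have [u v uv _] := egcdnP p a0; rewrite co in uv.
pose b0 : nat := b 0%N; pose a0' : nat := a 0%N.
exists (b0 * u)%N.
have -> : b - (b0 * u)%N%:R * a =
    (b - b0%:R) - (b0 * u)%N%:R * (a - a0'%:R) - p%:R * (b0 * v)%N%:R.
  have uvR : (u * a0')%N%:R = (v * p + 1)%N%:R :> padic p by rewrite uv.
  rewrite natrD !natrM in uvR; rewrite !natrM.
  have -> : b0%:R * u%:R * (a - a0'%:R) = b0%:R * u%:R * a - b0%:R * (u%:R * a0'%:R).
    by ring.
  by rewrite uvR; ring.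
apply: pidealB; first apply: pidealB.
- exact: pideal_nat_sub.
- by apply: pidealMl; exact: pideal_nat_sub.
- by apply: pidealMr; have := @pideal_pX p 1; rewrite expr1.
Qed.

(** Successive approximation: A^(p^k) - 1 has valuation exactly n+k, so adding a multiple of p^k to
    the exponent corrects the next digit of B - A^j. *)
Lemma one_unit_procyclic A B n : (1 < n)%N ->
  ideal n (A - 1) -> ~ ideal n.+1 (A - 1) -> ideal n (B - 1) ->
  forall k, exists j, ideal (n + k) (B - A ^+ j).
Proof.
move=> n1 An nAn Bn; elim=> [|k [j [b bE]]]; first by exists 0%N; rewrite expr0 addn0.
have n0 := ltnW n1.
have [a aE] := pideal_one_sub_expXp k n0 An.
have na : ~ ideal 1 a.
  move=> a1; apply: nAn; apply: (@pideal_one_sub_expXp_inv A n k) => //.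
  by rewrite aE -addn1; apply: pidealM => //; exact: pideal_pX.
have [e be] := pideal_mod_solve b na.
exists (j + p ^ k * e)%N; rewrite exprD exprM.
have [w wE] := exprD1_mod2 (A ^+ (p ^ k) - 1) e.
have a1E : 1 + (A ^+ (p ^ k) - 1) = A ^+ (p ^ k) by ring.
rewrite a1E aE in wE; rewrite wE.
set P := p%:R ^+ (n + k) in bE aE *.
(* Every term gains a factor p over [P]: the choice of [e] handles b - e a, A is 1 modulo p, and the
   last term contains P^2. *)
have -> : B - A ^+ j * (1 + e%:R * (P * a) + (P * a) ^+ 2 * w) =
   P * ((b - e%:R * a) - (A ^+ j - 1) * (e%:R * a)) - P * P * (A ^+ j * a ^+ 2 * w).
  have -> : B = A ^+ j + P * b by rewrite -bE; ring.
  ring.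
apply: pidealB.
  rewrite addnS -addn1; apply: pidealM; first exact: pideal_pX.
  apply: pidealB => //; apply: pidealMr; apply: pideal_one_sub_exp.
  exact: pideal_le An.
apply: pidealMr; apply: (@pideal_le _ _ ((n + k) + (n + k))).
  by rewrite addnS -addn1 leq_add2l addn_gt0 n0.
by apply: pidealM; exact: pideal_pX.
Qed.

End OneUnits.

(** * Indices of open subgroups and convergence of p-adic powers *)

Lemma range_card_eq (X Y : Type) (Z : pointedType) (f : X -> Y) (g : X -> Z) :
  (forall x y, f x = f y <-> g x = g y) -> (range f #= range g)%card.
Proof.
move=> fg; apply/card_set_bijP.
have h y : exists z, forall x, f x = y -> g x = z.
  have [[x <-]|nx] := pselect (exists x, f x = y); last first.
    by exists point => x xy; case: nx; exists x.
  by exists (g x) => x' /fg.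
pose k y := projT1 (cid (h y)).
have kE x : k (f x) = g x by rewrite /k; case: cid => z /= /(_ x erefl).
exists k; split.
- by move=> _ [x _ <-]; rewrite kE; exists x.
- by move=> _ _ /set_mem[x _ <-] /set_mem[y _ <-]; rewrite !kE => /fg.
- by move=> _ [x _ <-]; exists (f x); [exists x|exact: kE].
Qed.

(** As [U] contains the kernel of [q], its cosets correspond to those of q(U) in Z/p^(n+1), whose
    number divides p^(n+1). This gives the pro-p condition for both Z_p and Z/p. *)
Lemma coset_range_card (p n : nat) (B : groupType) (q : B -> 'Z_(p ^ n.+1))
    (U : set B) : prime p -> (forall b, exists g, q g = b) ->
  (forall g h, q (g * h) = (q g + q h)%R) -> subgroup U ->
  (forall g, q g = 0%R -> U g) ->
  exists k, (range (fun g : B => [set g * u | u in U]) #= `I_(p ^ k))%card.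
Proof.
move=> p_pr surj qM [U1 UM UV] kerU.
have p1 : (1 < p ^ n.+1)%N by rewrite -(exp1n n.+1) ltn_exp2r // prime_gt1.
have q1 : q 1 = 0%R by apply: (addrI (q 1)); rewrite -qM mulg1 addr0.
have qV g : q g^-1 = (- q g)%R.
  by apply: (addrI (q g)); rewrite -qM mulgV q1 subrr.
have UqP g : U g <-> exists2 u, U u & q u = q g.
  split=> [Ug|[u Uu qu]]; first by exists g.
  rewrite -(mulVKg u g); apply: UM => //; apply: kerU.
  by rewrite qM qV qu addNr.
pose H : {set 'Z_(p ^ n.+1)} := finset.finset (fun b => `[< exists2 u, U u & q u = b >]).
have HP b : reflect (exists2 u, U u & q u = b) (b \in H).
  by rewrite inE; exact: asboolP.
have gH : group_set H.
  apply/group_setP; split; first by apply/HP; exists 1.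
  move=> _ _ /HP[u Uu <-] /HP[v Uv <-]; apply/HP; exists (u * v); first exact: UM.
  exact: qM.
pose HG : {group 'Z_(p ^ n.+1)} := group gH.
pose L := lcosets HG [set: 'Z_(p ^ n.+1)]%G.
have Lg b : (b *: HG)%g \in L by rewrite -lcosetE; apply: imset_f; exact: finset.in_setT.
pose f g := enum_rank_in (Lg 0%R) (q g *: HG)%g.
have [k kE] : exists k, #|L| = (p ^ k)%N.
  have : (#|L| %| p ^ n.+1)%N.
    rewrite card_lcosets; apply: dvdn_trans (dvdn_indexg _ _) _.
    by rewrite cardsT card_ord Zp_cast.
  by move/(dvdn_pfactor _ _ p_pr) => [k _ ->]; exists k.
exists k.
have fE g h : f g = f h <-> U (g^-1 * h).
  rewrite UqP qM qV.
  have -> : f g = f h <-> (q g *: HG)%g = (q h *: HG)%g.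
    by split=> [|gh]; [apply: enum_rank_in_inj; exact: Lg|rewrite /f gh].
  have -> : (exists2 u, U u & q u = (- q g + q h)%R) <-> (- q g + q h)%R \in H.
    by split=> /HP.
  have -> : ((- q g + q h)%R \in H) = (q h \in (q g *: HG)%g) by rewrite mem_lcoset.
  by split=> [/esym|] /lcoset_eqP.
rewrite -kE.
have fsurj : range (fun g => (f g : nat)) = `I_#|L|.
  apply/seteqP; split=> [_ [g _ <-] /=|i /= lti]; first exact: ltn_ord.
  have := enum_valP (Ordinal lti); case/imsetP => b _ Eb.
  have [g gb] := surj b; exists g => //.
  have -> : f g = Ordinal lti; last by [].
  apply: enum_val_inj; rewrite /f enum_rankK_in //.
  by rewrite gb -lcosetE -Eb.
rewrite -fsurj; apply: range_card_eq => g h.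
rewrite (coset_set_eqP g h (And3 U1 UM UV)) -fE.
by split=> [->//|/val_inj].
Qed.

(** Compactness gives a cluster point. Modulo an open normal subgroup containing all p^k-th powers
    the sequence is constant from index k on, so the cluster point is the limit and the default
    value in [ppow] never occurs. *)
Lemma ppow_cvg (p : nat) (G : topGroupType) (g : G) (l : padic p) :
  prime p -> pro_p p G -> (g ^+ (l n : nat)) @[n --> \oo] --> ppow g l.
Proof.
move=> p_pr pG.
suff [y gy] : exists y : G, (fun n => g ^+ (l n : nat)) @ \oo --> y.
  by rewrite /ppow; case: xgetP => [z _ //|/(_ y)].
have [[cG hG dG] _] := pG.
have [y [_ gy]] := cG ((fun n => g ^+ (l n : nat)) @ \oo) _ filterT.
exists y => A Ay.
have A1 : nbhs (y * 1) A by rewrite mulg1.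
have {A1}A1 : nbhs 1 [set z | A (y * z)] := @mulgl_continuous G y 1 A A1.
have [U [nU oU UA]] := profinite_normal_basis (And3 cG hG dG) A1.
have [[U1 UM UV] UJ] := nU.
have [k Uk] := pro_p_expg_open pG nU oU.
have close m n : (k <= m)%N -> (k <= n)%N -> (m <= n)%N ->
    U ((g ^+ (l m : nat))^-1 * g ^+ (l n : nat)).
  move=> km kn mn; rewrite -(padic_res_mod p_pr l mn).
  rewrite {2}(divn_eq (l n) (p ^ m.+1)) expgD; set a := g ^+ (_ %% _)%N.
  have ca : a^-1 * (g ^+ (l n %/ p ^ m.+1 * p ^ m.+1) * a) = g ^+ (l n %/ p ^ m.+1 * p ^ m.+1) ^ a.
    by [].
  rewrite ca; apply: UJ.
  have -> : (l n %/ p ^ m.+1 * p ^ m.+1 = (l n %/ p ^ m.+1 * p ^ (m.+1 - k)) * p ^ k)%N.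
    by rewrite -mulnA -expnD subnK // leqW.
  by rewrite expgM; exact: Uk.
have Ukk : ((fun n => g ^+ (l n : nat)) @ \oo)
    [set z | exists2 n, (k <= n)%N & z = g ^+ (l n : nat)].
  by exists k => // n /= kn; exists n.
have yU : nbhs y [set z | U (y^-1 * z)].
  have U1' : nbhs (y^-1 * y) U by rewrite mulVg; apply: open_nbhs_nbhs.
  exact: (@mulgl_continuous G y^-1 y U U1').
have [_ [[m km ->] /= Um]] := gy _ _ Ukk yU.
have closem n : (k <= n)%N -> U ((g ^+ (l m : nat))^-1 * g ^+ (l n : nat)).
  move=> kn; have [mn|/ltnW nm] := leqP m n; first exact: close.
  by have := UV _ (close n m kn km nm); rewrite invgM invgK.
exists k => // n /= kn.
rewrite -(mulVKg y (g ^+ _)); apply: UA.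
by have := UM _ _ Um (closem n kn); rewrite mulgA mulgK.
Qed.

(** * The pro-p groups Z_p and Z/p *)

(** An alias carrying addition as a group law, so that Z_p can be a target of the universal
    properties. *)
Definition padic_add (p : nat) : Type := padic p.

Section PadicAdd.
Variable p : nat.
Local Notation pA := (padic_add p).

HB.instance Definition _ := Choice.copy pA (padic p).
HB.instance Definition _ := Topological.copy pA (padic p).
HB.instance Definition _ := isGroup.Build pA
  (@addrA (padic p)) (@add0r (padic p)) (@addr0 (padic p))
  (@addNr (padic p)) (@addrN (padic p)).

Fact padic_add_mul_continuous : continuous (fun z : pA * pA => z.1 * z.2).
Proof.
move=> [a b] A [n _ nA] /=.
exists (@padic_cyl p a n, @padic_cyl p b n); first by split; exists n.
move=> [c d] [/= ca db]; apply: nA => i lin /=.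
by rewrite (ca i lin) (db i lin).
Qed.

Fact padic_add_inv_continuous : continuous (fun z : pA => z^-1).
Proof.
move=> a A [n _ nA]; exists n => // c ca; apply: nA => i lin /=.
by rewrite (ca i lin).
Qed.

HB.instance Definition _ :=
  isTopGroup.Build pA padic_add_mul_continuous padic_add_inv_continuous.

Lemma padic_add_pro_p : prime p -> pro_p p pA.
Proof.
move=> p_pr; split.
  by split; [exact: padic_compact|exact: padic_hausdorff|exact: padic_totally_disconnected].
move=> U [sU _] oU.
have [n nU] : exists n, forall b : padic p, padic_ideal n b -> U b.
  have [U1 _ _] := sU.
  have : nbhs (0%R : padic p) U by exact: open_nbhs_nbhs.
  by move=> /(nbhs_padicP p_pr)[n nU]; exists n => b Ib; apply: nU; rewrite subr0.
apply: (@coset_range_card p n pA (fun a => (a : padic p) n)) => //.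
  by move=> b; exists ((b : nat)%:R : padic p)%R; exact: padic_nat_res.
move=> a an; apply: nU; apply: (@pideal_le _ n n.+1) => //.
by apply/pideal_resP => //; rewrite an.
Qed.

End PadicAdd.

(** The modulus is written [p ^ 1] so that component 0 of a p-adic integer is literally an element
    of this group. *)
Definition residue_grp (p : nat) : Type := 'Z_(p ^ 1).

Section ResidueGroup.
Variable p : nat.
Local Notation F := (residue_grp p).

HB.instance Definition _ := Choice.copy F 'Z_(p ^ 1).
HB.instance Definition _ := Topological.copy F (discrete_topology 'Z_(p ^ 1)).
HB.instance Definition _ := isGroup.Build F
  (@addrA 'Z_(p ^ 1)) (@add0r 'Z_(p ^ 1)) (@addr0 'Z_(p ^ 1))
  (@addNr 'Z_(p ^ 1)) (@addrN 'Z_(p ^ 1)).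

Lemma residue_nbhs (a : F) : nbhs a [set a].
Proof. exact: (@discrete_set1 (discrete_topology 'Z_(p ^ 1)) a). Qed.

Lemma residue_closed (A : set F) : closed A.
Proof. exact: (@discrete_closed (discrete_topology 'Z_(p ^ 1))). Qed.

Fact residue_mul_continuous : continuous (fun z : F * F => z.1 * z.2).
Proof.
move=> [a b] A /= /nbhs_singleton Aab.
exists ([set a], [set b]); first by split; exact: residue_nbhs.
by move=> [_ _] [/= -> ->].
Qed.

Fact residue_inv_continuous : continuous (fun z : F => z^-1).
Proof.
move=> a A /= /nbhs_singleton Aa; apply: (@filterS _ (nbhs a) _ [set a]).
  by move=> _ ->.
exact: residue_nbhs.
Qed.

HB.instance Definition _ :=
  isTopGroup.Build F residue_mul_continuous residue_inv_continuous.

Lemma residue_pro_p : prime p -> pro_p p F.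
Proof.
move=> p_pr; split; first split.
- exact: (@finite_compact F _ (@finite_finset 'Z_(p ^ 1) _)).
- exact: (@discrete_hausdorff (discrete_topology 'Z_(p ^ 1))).
- apply: zero_dimension_totally_disconnected.
  exact: (@discrete_zero_dimension (discrete_topology 'Z_(p ^ 1))).
move=> U [sU _] _.
apply: (@coset_range_card p 0 F id) => //; first by move=> b; exists b.
by move=> g ->; have [] := sU.
Qed.

End ResidueGroup.

(** * Kummerian pairs and cocycles *)

Lemma quotg_continuous (G : topGroupType) (N : set G) (hN : normal_subgroup N)
    (T : topologicalType) (f : quotg hN -> T) :
  continuous (f \o quotg_pi hN) -> continuous f.
Proof.
move=> cf a; have [x ->] := quotg_pi_surj a => A Afx.
have := nbhs_quotg_pi hN (cf x A Afx).
by apply: (@filterS _ (nbhs (quotg_pi hN x))) => _ [u Au <-].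
Qed.

Lemma subg_cvg (G : topGroupType) (H : set G) (hH : subgroup H) (T : Type)
    (D : set_system T) (FD : Filter D) (u : T -> subg_of hH) (y : subg_of hH) :
  (@subg_val _ _ hH \o u) @ D --> subg_val y -> u @ D --> y.
Proof.
move=> cu A; rewrite nbhsE => -[_ [[B oB <-] By] BA].
have nB : nbhs (subg_val y) B by exact: open_nbhs_nbhs.
by apply: (@filterS _ D _ _ _ _ (cu _ nB)) => t Bt; apply: BA.
Qed.

Lemma morph1g (G H : groupType) (f : G -> H) :
  {morph f : x y / x * y} -> f 1 = 1.
Proof. by move=> fM; apply: (mulgI (f 1)); rewrite -fM !mulg1. Qed.

Lemma morphVg (G H : groupType) (f : G -> H) :
  {morph f : x y / x * y} -> {morph f : x / x^-1}.
Proof.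
by move=> fM x; apply: (mulgI (f x)); rewrite -fM !mulgV morph1g.
Qed.

Lemma morphXg (G H : groupType) (f : G -> H) n :
  {morph f : x y / x * y} -> {morph f : x / x ^+ n}.
Proof.
move=> fM x; elim: n => [|n IH]; first by rewrite !expg0 morph1g.
by rewrite !expgS fM IH.
Qed.

Lemma quotg_factor (G H : topGroupType) (N : set G) (hN : normal_subgroup N)
    (f : G -> H) : continuous_hom f -> (forall z, N z -> f z = 1) ->
  exists f' : quotg hN -> H, continuous_hom f' /\ forall z, f' (quotg_pi hN z) = f z.
Proof.
move=> [cf fM] fN; pose f' (b : quotg hN) := f (repr b).
have f'E z : f' (quotg_pi hN z) = f z.
  rewrite /f'; set x := repr _.
  have /quotg_piP/fN : quotg_pi hN x = quotg_pi hN z by exact: quotg_reprK.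
  rewrite fM morphVg // => e.
  by rewrite -(mulVKg (f x) (f z)) e mulg1.
exists f'; split; last exact: f'E.
split.
- apply: quotg_continuous.
  by have -> : f' \o quotg_pi hN = f by apply: funext.
- move=> b c; have [x ->] := quotg_pi_surj b; have [y ->] := quotg_pi_surj c.
  by rewrite -quotg_piM !f'E fM.
Qed.

Section PadicPowers.
Variables (p : nat) (p_prime : prime p).

Lemma padic_add_expg (a : padic_add p) n : a ^+ n = (n%:R * (a : padic p))%R.
Proof.
elim: n => [|n IH]; first by rewrite expg0 mul0r.
by rewrite expgS IH -natr1 mulrDl mul1r addrC.
Qed.

Lemma residue_expg (a : residue_grp p) n : a ^+ n = (n%:R * (a : 'Z_(p ^ 1)))%R.
Proof.
elim: n => [|n IH]; first by rewrite expg0 mul0r.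
by rewrite expgS IH -natr1 mulrDl mul1r addrC.
Qed.

(** Linearity is asked only on powers of [h], so cocycles are covered as well as homomorphisms. The
    limit [w] is arbitrary because in Ker(theta) the power is constructed inside G. *)
Lemma cvg_expg_linear (G : topGroupType) (f : G -> padic p) (h w : G) (l d : padic p) :
  continuous f -> (forall n, f (h ^+ n) = (n%:R * d)%R) ->
  (h ^+ (l n : nat)) @[n --> \oo] --> w -> f w = (l * d)%R.
Proof.
move=> cf fX hw; apply/eqP; rewrite -subr_eq0; apply/eqP.
apply: (pideal_sep p_prime) => k.
have nk : nbhs (f w) [set b | padic_ideal k (b - f w)%R].
  by apply/(nbhs_padicP p_prime); exists k.
have [m _ mk] := hw _ (cf w _ nk).
have := mk (maxn m k) (leq_maxl _ _); rewrite /= fX => h1.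
have h2 := pideal_nat_sub p_prime l (maxn m k).
have {}h2 : padic_ideal k (l - (l (maxn m k) : nat)%:R)%R.
  by apply: pideal_le h2; rewrite leqW // leq_maxr.
have -> : (f w - l * d = - ((l (maxn m k) : nat)%:R * d - f w)
    - (l - (l (maxn m k) : nat)%:R) * d)%R by ring.
by apply: pidealB; [exact: pidealN|exact: pidealMr].
Qed.

Lemma residue_nat (l : padic p) n : ((l n : nat)%:R)%R = l 0%N :> 'Z_(p ^ 1).
Proof.
apply: ord_inj; rewrite -(padic_res_mod p_prime l (leq0n n)) val_Zp_nat //.
by rewrite -(exp1n 1) ltn_exp2r // prime_gt1.
Qed.

Lemma residue_hom_ppow (G : topGroupType) (f : G -> residue_grp p) (h : G) (l : padic p) :
  pro_p p G -> continuous_hom f -> f (ppow h l) = (l 0%N * f h)%R.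
Proof.
move=> pG [cf fM].
have [n _ nf] := @ppow_cvg p G h l p_prime pG _ (cf (ppow h l) _ (@residue_nbhs p _)).
by rewrite -(nf n (leqnn n)) morphXg // residue_expg residue_nat.
Qed.

End PadicPowers.

Section KummerianLift.
Variables (p : nat) (p_prime : prime p) (G : topGroupType).
Variable th : cyclotomic_pair p G.
Local Notation N := (cyclo_kerg th).
Local Notation ker := (cyclo_ker th).
Local Notation incl := (@subg_val _ _ (cyclo_ker_subgroup th)).

Lemma cyclo_res0 g : th g 0%N = 1%R.
Proof.
have /(pideal_resP p_prime) := cyclo_1p th g.
have -> : (th g - 1)%R 0%N = (th g 0%N - 1)%R by [].
by move=> h; apply/eqP; rewrite -subr_eq0; apply/eqP; apply: val_inj.
Qed.

Lemma cyclo_ker_ppow h (l : padic p) : ker h -> ker (ppow h l).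
Proof.
move=> kh.
have [[cG hG dG] _] := cyclo_pro_p th.
have thX n : th (h ^+ n) = 1%R.
  elim: n => [|n IH]; first by rewrite expg0 cyclo_theta1.
  by rewrite expgS cyclo_thetaM IH kh mulr1.
have := @ppow_cvg p G h l p_prime (cyclo_pro_p th).
move=> hl; rewrite /cyclo_ker /=.
have nk : nbhs (th (ppow h l)) (~` [set 1%R]) -> False.
  move=> nk; have [m _ /(_ m (leqnn m))] := hl _ (@cyclo_continuous _ _ th _ _ nk).
  by rewrite /= thX; apply.
apply: contrapT => ne; apply: nk; apply: open_nbhs_nbhs; split => //.
apply: closed_openC; apply: accessible_closed_set1; apply: hausdorff_accessible.
exact: padic_hausdorff.
Qed.

(** Since theta is 1 modulo p, [phi] kills the generators of K and descends to the free abelian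
    group Ker(theta)/K, where its values on a basis can be lifted to Z_p. The relations defining K
    become the equivariance of the lift. *)
Lemma kummerian_lift (phi : G -> residue_grp p) :
  kummerian th -> continuous_hom phi ->
  exists Psi : N -> padic p, [/\ continuous Psi,
    forall g h, Psi (g * h) = (Psi g + Psi h)%R,
    forall h, Psi h 0%N = phi (incl h) &
    forall (g : G) (h h' : N), incl h' = g * incl h * g^-1 ->
      Psi h' = (th g * Psi h)%R].
Proof.
move=> [I [a [[pA abA] a1 afree]]] hphi; have [cphi phiM] := hphi.
have pG := cyclo_pro_p th.
pose hK := cyclo_K_in_ker_normal th.
have phiK z : cyclo_K th z -> phi z = 1.
  move=> /(_ [set z | phi z = 1]) /=; apply; first split; first split; first split => /=.
  - exact: (morph1g phiM).
  - by move=> x y; rewrite phiM => -> ->; rewrite mulg1.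
  - by move=> x; rewrite morphVg // => ->; rewrite invg1.
  - by apply: (@closed_comp _ _ phi [set 1]) => [x _|]; [exact: cphi|exact: residue_closed].
  move=> _ [g [h [kh ->]]] /=; rewrite !phiM residue_hom_ppow // morphVg //.
  have -> : (- th g)%R 0%N = (-1)%R by rewrite -(cyclo_res0 g).
  rewrite mulN1r; change (- phi h + phi g + phi h - phi g = 0)%R; ring.
have [||phiA [[cphiA phiAM] phiAE]] := @quotg_factor _ _ _ hK (phi \o incl).
- split=> [h|g h]; last exact: phiM.
  by apply: continuous_comp; [exact: subg_val_continuous|exact: cphi].
- by move=> z; exact: phiK.
have fin_phiA : finite_set [set i | phiA (a i) <> 1].
  (* Z/p is discrete, so this kernel is open and almost all basis elements lie in it; as 0 is lifted
     to 0, the lifted family still converges to 1. *)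
  apply: (a1 (phiA @^-1` [set 1])).
  by apply: cphiA; rewrite morph1g //; exact: residue_nbhs.
pose y i : padic_add p := ((phiA (a i) : nat)%:R)%R.
have y1 : converges_to1 y.
  move=> U U1; apply: sub_finite_set fin_phiA => i /= nU e; apply: nU.
  by rewrite /y e; exact: nbhs_singleton.
have padd_ab : abelian_pro_p p (padic_add p).
  by split; [exact: padic_add_pro_p|exact: addrC].
have res_ab : abelian_pro_p p (residue_grp p).
  by split; [exact: residue_pro_p|exact: addrC].
have [psi [[[cpsi psiM] psia] _]] := afree _ y padd_ab y1.
have y'1 : converges_to1 (fun i => phiA (a i)).
  move=> U U1; apply: sub_finite_set fin_phiA => i /= nU e; apply: nU.
  by rewrite e; exact: nbhs_singleton.
(* The uniqueness clause with target Z/p identifies [psi] modulo p with [phiA], both having the same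
   values on the basis. *)
have [f0 [_ f0u]] := afree _ _ res_ab y'1.
have f0A : f0 = phiA by apply: f0u.
have f0psi : f0 = fun b => psi b 0%N.
  apply: f0u; split; first split.
  - move=> b A /nbhs_singleton Ab.
    have nb : nbhs (psi b : padic p) [set c | c 0%N = (psi b : padic p) 0%N].
      by exists 0%N => // c; exact.
    by apply: (@filterS _ (nbhs b) _ _ _ _ (cpsi b _ nb)) => c /= ->.
  - by move=> b c; rewrite psiM.
  - move=> i; by rewrite psia; exact: padic_nat_res.
exists (psi \o quotg_pi hK); split.
- move=> h; apply: continuous_comp; [exact: quotg_pi_continuous|exact: cpsi].
- by move=> g h /=; rewrite quotg_piM psiM.
- move=> h /=; rewrite -[phi (incl h)]phiAE -f0A f0psi //.
move=> g h h' e /=.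
have inclM : {morph incl : x y / x * y} by [].
pose w : N := Subg (cyclo_ker_subgroup th) (cyclo_ker_ppow (- th g)%R (subg_valP h)).
have cw : (h ^+ ((- th g)%R n : nat)) @[n --> \oo] --> w.
  apply: subg_cvg => /=.
  have -> : incl \o (fun n => h ^+ ((- th g)%R n : nat)) =
      fun n => incl h ^+ ((- th g)%R n : nat).
    by apply: funext => n /=; exact: (morphXg _ inclM).
  exact: ppow_cvg.
have psiw : psi (quotg_pi hK w) = (- th g * psi (quotg_pi hK h))%R.
  apply: (@cvg_expg_linear p p_prime N (psi \o quotg_pi hK) h w _ _ _ _ cw).
    move=> x; apply: continuous_comp; [exact: quotg_pi_continuous|exact: cpsi].
  move=> n /=; rewrite (morphXg n (@quotg_piM _ _ hK)) (morphXg n psiM).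
  exact: padic_add_expg.
(* [w * h'] is exactly the generator of K attached to [g] and [h]. *)
have wh : quotg_pi hK (w * h') = quotg_pi hK 1.
  apply/esym/quotg_piP; rewrite invg1 mul1g; apply: sub_gen_smallest.
  exists g, (incl h); split; first exact: subg_valP.
  by rewrite /= inclM e !mulgA.
have : psi (quotg_pi hK (w * h')) = 1 by rewrite wh !morph1g //; exact: quotg_piM.
rewrite quotg_piM psiM psiw => E.
apply: (@addrI (padic p) (- th g * psi (quotg_pi hK h))%R).
by rewrite {2}mulNr addNr.
Qed.

End KummerianLift.

Section PadicContinuity.
Variables (p : nat) (p_prime : prime p) (T : topologicalType).
Implicit Types (f g : T -> padic p).

Lemma padic_continuousD f g : continuous f -> continuous g ->
  continuous (fun x => f x + g x)%R.
Proof. exact: (@continuous_mulg T (padic_add p)). Qed.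

Lemma padic_continuousN f : continuous f -> continuous (fun x => - f x)%R.
Proof.
by move=> cf x; apply: (@continuous_comp _ (padic_add p) (padic_add p) f);
  [exact: cf|exact: (@invg_continuous (padic_add p))].
Qed.

Lemma padic_continuousM f g : continuous f -> continuous g ->
  continuous (fun x => f x * g x)%R.
Proof.
move=> /(padic_continuousP p_prime) cf /(padic_continuousP p_prime) cg.
apply/(padic_continuousP p_prime) => x n.
apply: (@filterS _ (nbhs x) _ _ _ _ (filterI (cf x n) (cg x n))) => y [fy gy].
have -> : (f y * g y - f x * g x = (f y - f x) * g y + f x * (g y - g x))%R by ring.
by apply: pidealD; [exact: pidealMr|exact: pidealMl].
Qed.

Lemma padic_continuousX f n : continuous f -> continuous (fun x => f x ^+ n)%R.
Proof.
move=> cf; elim: n => [|n IH].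
  by have -> : (fun x => f x ^+ 0)%R = cst 1%R by []; move=> x; exact: cvg_cst.
have -> : (fun x => f x ^+ n.+1)%R = (fun x => f x * f x ^+ n)%R.
  by apply: funext => x; rewrite exprS.
exact: padic_continuousM.
Qed.

Lemma padic_lift_continuous (f : T -> residue_grp p) : continuous f ->
  continuous (fun x => ((f x : nat)%:R : padic p))%R.
Proof.
move=> cf x A /nbhs_singleton Afx.
by apply: (@filterS _ (nbhs x) _ _ _ _ (cf x _ (@residue_nbhs p _))) => y /= ->.
Qed.

Lemma pideal1_sub (a b : padic p) : padic_ideal 1 (a - b)%R <-> a 0%N = b 0%N.
Proof.
rewrite pideal_resP //; have -> : (a - b)%R 0%N = (a 0%N - b 0%N)%R by [].
split=> [h|->]; last by rewrite subrr.
by apply/eqP; rewrite -subr_eq0; apply/eqP; exact: ord_inj.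
Qed.

End PadicContinuity.

(** * Extension of the lift from Ker(theta) to G *)

Section Cocycles.
Variables (p : nat) (p_prime : prime p) (G : topGroupType).
Variable th : cyclotomic_pair p G.
Hypothesis th_tf : torsion_free_pair th.
Local Notation N := (cyclo_kerg th).
Local Notation ker := (cyclo_ker th).
Local Notation incl := (@subg_val _ _ (cyclo_ker_subgroup th)).
Local Notation ideal := (@padic_ideal p).

Lemma minimal_one_unit : (exists g, th g <> 1%R) ->
  exists (g0 : G) (n : nat), [/\ (1 < n)%N, ~ ideal n.+1 (th g0 ^+ p - 1)%R &
    forall g, ideal n (th g ^+ p - 1)%R].
Proof.
move=> [g1 g1N].
(* Passing to p-th powers is harmless, Im(theta) being torsion free, and puts
   us in 1 + p^2 Z_p, whose closed subgroups are procyclic also for p = 2. *)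
pose P n := `[< exists g, ~ ideal n.+1 (th g ^+ p - 1)%R >].
have exP : exists n, P n.
  have /(pideal_valuation p_prime)[v [_ nv]] : (th g1 ^+ p - 1)%R <> 0%R.
    move=> /eqP; rewrite subr_eq0 => /eqP t1.
    by apply: g1N; apply: (th_tf _ t1); exact: prime_gt0.
  by exists v; apply/asboolP; exists g1.
(* [n] is the least valuation of the theta(g)^p - 1, attained at [g0]; it is at least 2 because p-th
   powers of one-units lie in 1 + p^2 Z_p. *)
case: (ex_minnP exP) => n /asboolP[g0 ng0] nmin.
exists g0, n; split => //.
  rewrite ltnNge; apply/negP => n1; apply: ng0.
  apply: (@pideal_le _ n.+1 2) => //.
  by apply: pideal_one_sub_expp => //; exact: cyclo_1p.
move=> g; case: n nmin {ng0} => [|n] nmin; first exact: pideal0.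
apply: contrapT => ng; suff : (n.+1 <= n)%N by rewrite ltnn.
by apply: nmin; apply/asboolP; exists g.
Qed.

(* If c restricts to Psi on Ker and c g0 = alpha, evaluating the cocycle
   identity on g0 g = [g0 g g0^-1 g^-1] g g0 forces
   (th g0 - 1) c g = Psi (g0 g g0^-1 g^-1) + alpha (th g - 1). *)
Lemma cocycle_of_generator (g0 : G) (n m : nat) (u : padic p)
    (phi : G -> residue_grp p) (Psi : N -> padic p) :
  (1 < n)%N -> ~ ideal n.+1 (th g0 ^+ p - 1)%R ->
  (forall g, ideal n (th g ^+ p - 1)%R) ->
  (th g0 - 1 = p%:R ^+ m * u)%R ->
  continuous_hom phi -> continuous Psi ->
  (forall g h, Psi (g * h) = (Psi g + Psi h)%R) ->
  (forall h, Psi h 0%N = phi (incl h)) ->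
  (forall (g : G) (h h' : N), incl h' = g * incl h * g^-1 ->
      Psi h' = (th g * Psi h)%R) ->
  exists c : G -> padic p, [/\ continuous c,
    forall g h, c (g * h) = (c g + th g * c h)%R &
    forall g, c g 0%N = (u 0%N * phi g)%R].
Proof.
move=> n1 ng0 tn du [cphi phiM] cPsi PsiM Psi0 Psiconj.
have thV g : (th g * th (g^-1)%g = 1)%R by rewrite -cyclo_thetaM mulgV cyclo_theta1.
have kcomm g : ker (g0 * g * g0^-1 * g^-1).
  rewrite /cyclo_ker /= !cyclo_thetaM.
  have -> : (th g0 * th g * th (g0^-1)%g * th (g^-1)%g =
    (th g0 * th (g0^-1)%g) * (th g * th (g^-1)%g))%R by ring.
  by rewrite !thV mulr1.
pose comm g : N := Subg (cyclo_ker_subgroup th) (kcomm g).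
have commE g : incl (comm g) = g0 * g * g0^-1 * g^-1 by [].
have ccomm : continuous comm.
  apply: subg_continuous.
  have -> : incl \o comm = fun g => g0 * g * g0^-1 * g^-1 by [].
  apply: continuous_mulg; last exact: invg_continuous.
  apply: (continuous_mulg (f := fun g => g0 * g)); first exact: mulgl_continuous.
  by move=> g; exact: cvg_cst.
pose L (a : residue_grp p) : padic p := ((a : nat)%:R)%R.
have L0 a : L a 0%N = a by exact: padic_nat_res.
pose num g := (Psi (comm g) + L (phi g0) * (th g - 1))%R.
have cnum : continuous num.
  apply: padic_continuousD => //.
    by move=> g; apply: continuous_comp; [exact: ccomm|exact: cPsi].
  apply: padic_continuousM => //; first by move=> g; exact: cvg_cst.
  apply: padic_continuousD; first exact: cyclo_continuous.
  by move=> g; exact: cvg_cst.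
have numM g h : num (g * h) = (num g + th g * num h)%R.
  have kk : ker (g * incl (comm h) * g^-1).
    by rewrite /cyclo_ker /= cyclo_thetaM cyclo_thetaM (kcomm h) mulr1 thV.
  pose k : N := Subg (cyclo_ker_subgroup th) kk.
  have commM : comm (g * h) = comm g * k.
    apply: subg_val_inj; rewrite /= -[incl (comm g * k)]/(incl (comm g) * incl k).
    rewrite -[incl k]/(g * incl (comm h) * g^-1) !commE invgM !mulgA.
    by rewrite !mulgVK.
  rewrite /num commM PsiM (@Psiconj g (comm h) k erefl) cyclo_thetaM; ring.
(* Membership in [Z] yields both facts needed: p^m divides [num g], and the quotient reduces to u
   phi(g). Modulus p^(m+1) suffices for stability under products, as [L] is additive modulo p. *)
pose Z := [set g | ideal m.+1 (num g - (th g0 - 1) * L (phi g))%R].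
have d_m : ideal m (th g0 - 1)%R by rewrite du; apply: pidealMr; exact: pideal_pX.
have ZM g h : Z g -> Z h -> Z (g * h).
  rewrite /Z /= => Zg Zh; rewrite numM.
  have -> : (num g + th g * num h - (th g0 - 1) * L (phi (g * h)%g) =
     (num g - (th g0 - 1) * L (phi g)) + th g * (num h - (th g0 - 1) * L (phi h)) +
     (th g0 - 1) * ((th g - 1) * L (phi h) - (L (phi (g * h)%g) - (L (phi g) + L (phi h)))))%R.
    ring.
  apply: pidealD; first by apply: pidealD => //; exact: pidealMl.
  rewrite -addn1; apply: pidealM => //; apply: pidealB.
    by apply: pidealMr; exact: cyclo_1p.
  apply/pideal1_sub => //; rewrite L0 phiM.
  have -> : (L (phi g) + L (phi h))%R 0%N = (L (phi g) 0%N + L (phi h) 0%N)%R by [].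
  by rewrite !L0.
have Zker g : ker g -> Z g.
  move=> kg; pose h : N := Subg (cyclo_ker_subgroup th) kg.
  (* For g in the kernel [comm g * h] is g0 h g0^-1, so equivariance gives Psi(comm g) = (theta(g0)
     - 1) Psi(h). *)
  have := @Psiconj g0 h (comm g * h) (mulgVK _ _).
  rewrite PsiM => /(canRL (addrK _)) E.
  rewrite /Z /= /num E kg.
  have -> : (th g0 * Psi h - Psi h + L (phi g0) * (1 - 1) - (th g0 - 1) * L (phi g) =
    (th g0 - 1) * (Psi h - L (phi g)))%R by ring.
  by rewrite -addn1; apply: pidealM => //; apply/pideal1_sub => //; rewrite L0 Psi0.
have Zg0 : Z g0.
  rewrite /Z /=; have -> : num g0 = ((th g0 - 1) * L (phi g0))%R.
    rewrite /num; have -> : comm g0 = 1 by apply: subg_val_inj; rewrite commE mulgK mulgV.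
    have -> : Psi 1 = 0%R by apply: (addrI (Psi 1)); rewrite -PsiM mulg1 addr0.
    by rewrite add0r mulrC.
  by rewrite subrr; exact: pideal_zero.
have Zcl : closed Z.
  apply: (@closed_comp _ _ (fun g => num g - (th g0 - 1) * L (phi g))%R (ideal m.+1)).
    move=> g _; apply: padic_continuousD => //; apply: padic_continuousN.
    apply: padic_continuousM => //; first by move=> ?; exact: cvg_cst.
    exact: padic_lift_continuous.
  exact: pideal_closed.
have ZT g : Z g.
  have [[cG hG dG] _] := cyclo_pro_p th.
  have cZ : compact Z by apply: (subclosed_compact _ cG).
  (* This set is closed and contains all powers of theta(g0)^p, hence every theta(g)^p. Torsion
     freeness then gives theta(z) = theta(g) for some z in [Z], so g differs from z by a kernel
     element. *)
  have cW : closed [set (th z ^+ p)%R | z in Z].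
    apply: compact_closed; first exact: padic_hausdorff.
    apply: continuous_compact => //; apply: continuous_subspaceT.
    by apply: padic_continuousX => //; exact: cyclo_continuous.
  have Zg0X j : Z (g0 ^+ j).
    elim: j => [|j IH]; last by rewrite expgS; exact: ZM.
    by rewrite expg0; apply: Zker; rewrite /cyclo_ker /= cyclo_theta1.
  have thX j : th (g0 ^+ j) = (th g0 ^+ j)%R.
    elim: j => [|j IH]; first by rewrite expg0 cyclo_theta1 expr0.
    by rewrite expgS cyclo_thetaM IH exprS.
  have [z Zz zg] : [set (th z ^+ p)%R | z in Z] (th g ^+ p)%R.
    apply: contrapT => nW.
    have : nbhs (th g ^+ p)%R (~` [set (th z ^+ p)%R | z in Z]).
      by apply: open_nbhs_nbhs; split => //; exact: closed_openC.
    move=> /(nbhs_padicP p_prime)[k kW].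
    have [j] := one_unit_procyclic p_prime n1 (tn g0) ng0 (tn g) k.
    move=> /pideal_sub_sym/(pideal_le (leq_addl n k))/kW; apply.
    by exists (g0 ^+ j) => //; rewrite thX -!exprM mulnC.
  rewrite -(mulVKg z g); apply: ZM => //; apply: Zker.
  rewrite /cyclo_ker /=; apply: (th_tf (prime_gt0 p_prime)).
  rewrite cyclo_thetaM exprMn -zg -exprMn mulrC thV expr1n //.
have numm g : exists c, (num g = p%:R ^+ m * c)%R.
  suff : ideal m (num g) by [].
  have -> : (num g = (num g - (th g0 - 1) * L (phi g)) + (th g0 - 1) * L (phi g))%R by ring.
  apply: pidealD; last exact: pidealMr.
  by apply: (pideal_le _ (ZT g)).
pose c g := projT1 (cid (numm g)).
have cE g : (num g = p%:R ^+ m * c g)%R by rewrite /c; case: cid.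
exists c; split.
- apply/(padic_continuousP p_prime) => g k.
  have := (iffLR (padic_continuousP p_prime num) cnum) g (m + k)%N.
  apply: (@filterS _ (nbhs g)) => h; rewrite !cE -mulrBr.
  exact: pideal_cancel_pX.
- move=> g h; apply: (mul_pX_inj p_prime (m := m)).
  by rewrite -cE numM !cE; ring.
- move=> g.
  have := ZT g; rewrite /Z /= cE du.
  have -> : (p%:R ^+ m * c g - p%:R ^+ m * u * L (phi g) =
    p%:R ^+ m * (c g - u * L (phi g)))%R by ring.
  rewrite -addn1 => /(pideal_cancel_pX p_prime)/(pideal1_sub p_prime) ->.
  by have -> : (u * L (phi g))%R 0%N = (u 0%N * L (phi g) 0%N)%R by []; rewrite L0.
Qed.

(** [u] is chosen before [phi], so all lifts carry the same factor. For trivial theta the kernel is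
    G and the lift itself serves with u = 1. *)
Lemma kummerian_cocycle : kummerian th ->
  exists u : padic p, ~ ideal 1 u /\
    forall phi : G -> residue_grp p, continuous_hom phi ->
    exists c : G -> padic p, [/\ continuous c,
      forall g h, c (g * h) = (c g + th g * c h)%R &
      forall g, c g 0%N = (u 0%N * phi g)%R].
Proof.
move=> kum.
have [triv|ntriv] := pselect (forall g, th g = 1%R).
  exists 1%R; split.
    rewrite -[1%R]/(1%:R)%R pideal1_nat // => /(dvdn_leq (ltn0Sn 0)).
    by rewrite leqNgt prime_gt1.
  move=> phi hphi; have [Psi [cPsi PsiM Psi0 _]] := kummerian_lift p_prime kum hphi.
  pose s g : N := Subg (cyclo_ker_subgroup th) (triv g).
  have sM g h : s (g * h) = s g * s h by exact: subg_val_inj.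
  exists (Psi \o s); split.
  - move=> g; apply: continuous_comp; last exact: cPsi.
    by apply: subg_continuous => x; exact: cvg_id.
  - by move=> g h /=; rewrite sM PsiM triv mul1r.
  - by move=> g /=; rewrite Psi0 mul1r.
have [g1 g1N] : exists g, th g <> 1%R.
  by apply: contrapT => h; apply: ntriv => g; apply: contrapT => ?; apply: h; exists g.
have [g0 [n [n1 ng0 tn]]] := minimal_one_unit (ex_intro _ g1 g1N).
have d0 : (th g0 - 1)%R <> 0%R.
  move=> /eqP; rewrite subr_eq0 => /eqP t1; apply: ng0.
  by rewrite t1 expr1n subrr; exact: pideal_zero.
have [m [[u du] nm]] := pideal_valuation p_prime d0.
exists u; split.
  by move=> u1; apply: nm; rewrite du -addn1; apply: pidealM => //; exact: pideal_pX.
move=> phi hphi; have [Psi [cPsi PsiM Psi0 PsiJ]] := kummerian_lift p_prime kum hphi.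
exact: (cocycle_of_generator n1 ng0 tn du hphi cPsi PsiM Psi0 PsiJ).
Qed.

End Cocycles.

(** * Cocycles on S and the relation r *)

Section CocycleOnGroup.
Variables (p : nat) (p_prime : prime p) (S : topGroupType) (S_pro_p : pro_p p S).
Variables (t c : S -> padic p).
Hypothesis t_cont : continuous t.
Hypothesis c_cont : continuous c.
Hypothesis t1 : t 1 = 1%R.
Hypothesis tM : forall g h, t (g * h) = (t g * t h)%R.
Hypothesis t_1p : forall g, padic_ideal 1 (t g - 1)%R.
Hypothesis t_tf : forall g n, (0 < n)%N -> (t g ^+ n = 1)%R -> t g = 1%R.
Hypothesis cM : forall g h, c (g * h) = (c g + t g * c h)%R.
Local Notation ideal := (@padic_ideal p).

Let tV g : (t g * t (g^-1)%g = 1)%R. Proof. by rewrite -tM mulgV. Qed.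

Let tX g n : t (g ^+ n) = (t g ^+ n)%R.
Proof.
elim: n => [|n IH]; first by rewrite expg0 t1 expr0.
by rewrite expgS tM IH exprS.
Qed.

Let c1 : c 1 = 0%R.
Proof. by apply: (addrI (c 1)); rewrite -{2}(mul1r (c 1)) -{1}t1 -cM mulg1 addr0. Qed.

Let cV g : c g^-1 = (- (t (g^-1)%g * c g))%R.
Proof.
have := cM g^-1 g; rewrite mulVg c1 => /esym/eqP.
by rewrite addr_eq0 => /eqP.
Qed.

Let closed_preimage (f : S -> padic p) n : continuous f -> closed [set g | ideal n (f g)].
Proof.
move=> cf; apply: (@closed_comp _ _ f (ideal n)) => [g _|]; first exact: cf.
exact: pideal_closed.
Qed.

Let closed_zero (f : S -> padic p) : continuous f -> closed [set g | f g = 0%R].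
Proof.
move=> cf.
have -> : [set g | f g = 0%R] = \bigcap_n [set g | ideal n (f g)].
  apply/seteqP; split=> g /= fg; first by move=> n _ /=; rewrite fg; exact: pideal_zero.
  by apply: (pideal_sep p_prime) => n; exact: fg.
by apply: closed_bigI => n _; exact: closed_preimage.
Qed.

Lemma cocycle_zero_closed_gen (A : set S) :
  (forall g, A g -> c g = 0%R) -> forall g, closed_gen A g -> c g = 0%R.
Proof.
move=> A0 g /(_ [set g | c g = 0%R]); apply; split; last by move=> x /A0.
split; last exact: closed_zero.
split=> [|x y|x] /=; first exact: c1.
  by rewrite cM => -> ->; rewrite mulr0 addr0.
by rewrite cV => ->; rewrite mulr0 oppr0.
Qed.

Lemma character_derived g : derived_closed S g -> t g = 1%R.
Proof.
move=> /(_ [set g | t g = 1%R]); apply; split; last first.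
  move=> _ [x [y ->]] /=; rewrite /commg /conjg !tM.
  have -> : (t (x^-1)%g * (t (y^-1)%g * (t x * t y)) =
    (t x * t (x^-1)%g) * (t y * t (y^-1)%g))%R by ring.
  by rewrite !tV mulr1.
split; last first.
  have -> : [set g | t g = 1%R] = [set g | (t g - 1)%R = 0%R].
    apply/seteqP; split=> x /= => [->|/eqP]; first by rewrite subrr.
    by rewrite subr_eq0 => /eqP.
  apply: closed_zero; apply: padic_continuousD => //.
  by move=> x; exact: cvg_cst.
split=> [|x y|x] /=; first exact: t1.
  by rewrite tM => -> ->; rewrite mulr1.
by move=> x1; rewrite -(mul1r (t x^-1)) -{1}x1 tV.
Qed.

Let cX g n i : ideal i.+1 (t g - 1)%R -> ideal i.+1 (c (g ^+ n)%g - n%:R * c g)%R.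
Proof.
move=> tg; elim: n => [|n IH].
  by rewrite expg0 c1 mul0r subrr; exact: pideal_zero.
rewrite expgS cM -natr1.
have -> : (c g + t g * c (g ^+ n)%g - (n%:R + 1) * c g =
  (c (g ^+ n)%g - n%:R * c g) + (t g - 1) * c (g ^+ n)%g)%R by ring.
by apply: pidealD => //; exact: pidealMr.
Qed.

(** The two estimates must be proved together: c(x^p) is p c(x) only modulo theta(x) - 1, and c of a
    commutator involves theta - 1 at both entries. The bound on theta is one power of p better
    because it starts from 1 + p Z_p. *)
Lemma cocycle_lower_pcentral i g : lower_pcentral S p i.+1 g ->
  ideal i.+1 (t g - 1)%R /\ ideal i (c g).
Proof.
rewrite /lower_pcentral /=; elim: i g => [|i IH] g; first by split; [|exact: pideal0].
move=> /(_ [set g | ideal i.+2 (t g - 1)%R /\ ideal i.+1 (c g)]); apply; split.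
  split; last first.
    have -> : [set g | ideal i.+2 (t g - 1)%R /\ ideal i.+1 (c g)] =
      [set g | ideal i.+2 (t g - 1)%R] `&` [set g | ideal i.+1 (c g)] by [].
    apply: closedI; last exact: closed_preimage.
    apply: (@closed_preimage (fun g => t g - 1)%R).
    by apply: padic_continuousD => //; move=> x; exact: cvg_cst.
  split=> [|x y [tx cx] [ty cy]|x [tx cx]] /=.
  - by rewrite t1 subrr c1; split; exact: pideal_zero.
  - rewrite tM cM; split; last by apply: pidealD => //; exact: pidealMl.
    have -> : (t x * t y - 1 = t x * (t y - 1) + (t x - 1))%R by ring.
    by apply: pidealD => //; exact: pidealMl.
  - rewrite cV; split; last by apply: pidealN; exact: pidealMl.
    have -> : (t (x^-1)%g - 1 = - (t (x^-1)%g * (t x - 1)) + (t x * t (x^-1)%g - 1))%R by ring.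
    by rewrite tV subrr addr0; apply: pidealN; exact: pidealMl.
move=> _ [[x Ax <-]|[y [x [Ax ->]]]] /=; have [tx cx] := IH x Ax.
  rewrite tX; split; first exact: pideal_one_sub_expp.
  have -> : c (x ^+ p) = ((c (x ^+ p)%g - p%:R * c x) + p%:R * c x)%R by ring.
  apply: pidealD; first exact: cX.
  by rewrite -add1n; apply: pidealM => //; rewrite -(expr1 p%:R); exact: pideal_pX.
have tyx : t [~ y, x] = 1%R by apply: character_derived; apply: sub_gen_smallest; exists y, x.
rewrite tyx subrr; split; first exact: pideal_zero.
(* Obtained by expanding [c] on both sides of yx = xy[y,x]. *)
have E : (t (x * y)%g * c [~ y, x] = (t y - 1) * c x - (t x - 1) * c y)%R.
  have := congr1 c (commgC y x); rewrite !cM => /esym/(canRL (addKr _)) ->; ring.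
have -> : c [~ y, x] = (t (x * y)^-1%g * (t (x * y)%g * c [~ y, x]))%R.
  by rewrite mulrA [X in (X * _)%R]mulrC tV mul1r.
rewrite E; apply: pidealMl; apply: pidealB; last exact: pidealMr.
by rewrite -add1n; apply: pidealM.
Qed.

Section Generator.
Variables (x0 : S) (l D : padic p).
Hypotheses (cx0 : c x0 = D) (D_unit : ~ ideal 1 D).

Let x0_cvg : (x0 ^+ (l n : nat)) @[n --> \oo] --> ppow x0 l.
Proof. exact: ppow_cvg. Qed.

(** [f g] equals c(x0 g) - c(g x0), so it vanishes on powers of [x0] and on their limits. With c = 0
    at the limit only (t - 1) D = 0 remains, and the unit [D] cancels. *)
Lemma cocycle_ppow_zero : c (ppow x0 l) = 0%R -> t (ppow x0 l) = 1%R.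
Proof.
move=> cy0.
pose f g := ((t x0 - 1) * c g - (t g - 1) * D)%R.
have : f (ppow x0 l) = (l * 0)%R.
  apply: (@cvg_expg_linear p p_prime S f x0 _ l 0%R _ _ x0_cvg).
    have cst_cont (a : padic p) : continuous (fun _ : S => a) by move=> ?; exact: cvg_cst.
    apply: padic_continuousD; first exact: padic_continuousM.
    apply: padic_continuousN; apply: padic_continuousM => //.
    exact: padic_continuousD.
  elim=> [|n IH]; first by rewrite /f expg0 c1 t1; ring.
  move: IH; rewrite /f !mulr0 expgS cM tM cx0 => /eqP; rewrite subr_eq0 => /eqP IH.
  rewrite mulrDr mulrCA IH; ring.
rewrite /f cy0 !mulr0 sub0r => /eqP; rewrite oppr_eq0 => /eqP tD.
apply/eqP; rewrite -subr_eq0; apply/eqP; apply: (pideal_sep p_prime) => n.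
by apply: (pideal_cancel_unit p_prime D_unit); rewrite mulrC tD; exact: pideal_zero.
Qed.

(** If [l] has valuation v, its late residues are p^v w with w prime to p. Then b = t(x0)^(p^v)
    satisfies b^w = 1 to any precision, and since w is a unit b = 1 follows one digit at a time;
    torsion freeness removes p^v. *)
Lemma character_ppow_one : l <> 0%R -> t (ppow x0 l) = 1%R -> t x0 = 1%R.
Proof.
move=> l0 ty1; have [v [lv nlv]] := pideal_valuation p_prime l0.
apply: (t_tf (n := p ^ v)); first by rewrite expn_gt0 prime_gt0.
set b := (t x0 ^+ (p ^ v))%R.
apply/eqP; rewrite -subr_eq0; apply/eqP; apply: (pideal_sep p_prime).
case=> [|K]; first exact: pideal0.
elim: K => [|K IH]; first by apply: pideal_one_sub_exp.
have nK : nbhs (t (ppow x0 l)) [set a | ideal K.+2 (a - t (ppow x0 l))%R].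
  by apply/(nbhs_padicP p_prime); exists K.+2.
have [m _ /(_ (maxn m v) (leq_maxl _ _))] := x0_cvg (t_cont nK).
rewrite /= ty1 tX.
have := pideal_nat_sub p_prime l (maxn m v); set q := nat_of_ord _ => lq.
have {}lq : ideal v.+1 (l - q%:R)%R by apply: pideal_le lq; rewrite ltnS leq_maxr.
have qv : (p ^ v %| q)%N.
  apply/(pideal_natP p_prime).
  have -> : q%:R%R = (l - (l - q%:R))%R :> padic p by ring.
  by apply: pidealB => //; apply: pideal_le lq.
have nqv : ~~ (p ^ v.+1 %| q)%N.
  apply/negP => /(pideal_natP p_prime) h; apply: nlv.
  by rewrite -(subrK q%:R%R l); exact: pidealD.
have [w qE] := dvdnP qv.
rewrite qE mulnC exprM => h; apply: (@pideal_one_sub_coprime_exp _ p_prime b K.+1 w) => //.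
by apply: contra nqv; rewrite qE expnS => pw; exact: dvdn_mul.
Qed.

Lemma cocycle_ppow : t x0 = 1%R -> c (ppow x0 l) = (l * D)%R.
Proof.
move=> tx; apply: (cvg_expg_linear p_prime c_cont _ x0_cvg) => n.
elim: n => [|n IH]; first by rewrite expg0 c1 mul0r.
by rewrite expgS cM tx IH cx0 -natr1; ring.
Qed.

End Generator.

End CocycleOnGroup.

(** Named so that it can carry the ring morphism structure with which determinants are reduced
    modulo p. *)
Definition padic_residue (p : nat) (a : padic p) : 'Z_(p ^ 1) := a 0%N.

Section PadicResidue.
Variable p : nat.

HB.instance Definition _ := GRing.isZmodMorphism.Build (padic p) 'Z_(p ^ 1)
  (@padic_residue p) (fun _ _ => erefl).
HB.instance Definition _ := GRing.isMonoidMorphism.Build (padic p) 'Z_(p ^ 1)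
  (@padic_residue p) (conj erefl (fun _ _ => erefl)).

End PadicResidue.

(** * A cocycle concentrated on the first basis element *)

Section DualCocycle.
Variables (p : nat) (p_prime : prime p).
Local Notation ideal := (@padic_ideal p).

Lemma pideal1_exp (u : padic p) n : ~ ideal 1 u -> ~ ideal 1 (u ^+ n)%R.
Proof.
move=> nu; elim: n => [|n IH]; last first.
  by rewrite exprS => /(pideal_cancel_unit p_prime nu).
rewrite expr0 -[1%R]/(1%:R)%R pideal1_nat // => /(dvdn_leq (ltn0Sn 0)).
by rewrite leqNgt prime_gt1.
Qed.

Lemma det_unit (n : nat) (M : 'M[padic p]_n) (u : padic p) :
  ~ ideal 1 u -> (forall i j, padic_residue (M i j) = padic_residue u *+ (i == j))%R ->
  ~ ideal 1 (\det M)%R.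
Proof.
move=> nu Mu dM; apply: (pideal1_exp (n := n) nu).
have : padic_residue (\det M)%R = padic_residue (u ^+ n)%R.
  rewrite -det_map_mx (_ : map_mx _ M = (padic_residue u)%:M)%R; last first.
    by apply/matrixP => i j; rewrite [LHS]mxE [RHS]mxE; exact: Mu.
  by rewrite det_scalar rmorphXn.
move=> /(pideal1_sub p_prime) E.
by rewrite -(subKr (\det M)%R (u ^+ n)%R); apply: pidealB.
Qed.

Lemma padic_continuous_sum (T : topologicalType) (I : Type) (r : seq I)
    (f : I -> T -> padic p) : (forall i, continuous (f i)) ->
  continuous (fun x => \sum_(i <- r) f i x)%R.
Proof.
move=> cf; elim: r => [|i r IH].
  have -> : (fun x => \sum_(i <- [::]) f i x)%R = cst 0%R.
    by apply: funext => x; rewrite big_nil.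
  by move=> x; exact: cvg_cst.
have -> : (fun x => \sum_(j <- i :: r) f j x)%R = (fun x => f i x + \sum_(j <- r) f j x)%R.
  by apply: funext => x; rewrite big_cons.
exact: padic_continuousD.
Qed.

Lemma frattini_residue_hom (S : topGroupType) (f : S -> residue_grp p) :
  continuous_hom f -> forall g, frattini_p S p g -> f g = 1.
Proof.
move=> [cf fM] g /(_ [set z | f z = 1]); apply; split; first split.
- split=> [|x y|x] /=; first exact: morph1g.
    by rewrite fM => -> ->; rewrite mulg1.
  by rewrite morphVg // => ->; rewrite invg1.
- by apply: (@closed_comp _ _ f [set 1]) => [x _|]; [exact: cf|exact: residue_closed].
move=> _ [[x _ <-]|[y [x [_ ->]]]] /=.
  rewrite morphXg // residue_expg.
  have -> : (p%:R = 0 :> 'Z_(p ^ 1))%R; last by rewrite mul0r.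
  by apply: ord_inj; rewrite val_Zp_nat ?[X in (p %% X)%N]expn1 ?modnn //
    expn1 prime_gt1.
rewrite /commg /conjg !fM !morphVg //.
by change (- f y + (- f x + (f y + f x)) = 0)%R; ring.
Qed.

Lemma dual_cocycle (d : nat) (S : topGroupType) (x : 'I_d.+1 -> S) (R : set S)
    (R_normal : normal_subgroup R) (th : cyclotomic_pair p (quotg R_normal)) :
  free_pro_p p x -> R `<=` frattini_p S p ->
  torsion_free_pair th -> kummerian th ->
  exists (c : S -> padic p) (D : padic p), [/\ continuous c,
    forall g h, c (g * h) = (c g + th (quotg_pi R_normal g) * c h)%R,
    ~ ideal 1 D, forall i, c (x i) = (D *+ (i == ord0))%R &
    forall r, R r -> c r = 0%R].
Proof.
move=> [pS x1 xfree] RF tf kum.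
have [u [nu cocyc]] := kummerian_cocycle p_prime tf kum.
pose pi := quotg_pi R_normal.
have dual k : exists f : quotg R_normal -> residue_grp p,
    continuous_hom f /\ forall i, f (pi (x i)) = ((i == k)%:R : 'Z_(p ^ 1))%R.
  have [||f [[hf fx] _]] :=
    xfree (residue_grp p) (fun i => ((i == k)%:R : 'Z_(p ^ 1))%R).
  - exact: residue_pro_p.
  - by move=> U _; exact: finite_finset.
  have [|f' [hf' f'E]] := quotg_factor R_normal hf.
    by move=> z /RF; exact: frattini_residue_hom.
  by exists f'; split => // i; rewrite f'E fx.
have dualc k : exists c : quotg R_normal -> padic p, [/\ continuous c,
    forall g h, c (g * h) = (c g + th g * c h)%R &
    forall i, padic_residue (c (pi (x i))) = (padic_residue u *+ (i == k))%R].
  have [f [hf fx]] := dual k; have [c [cc cM c0]] := cocyc f hf.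
  exists c; split => // i; rewrite /padic_residue c0 fx; exact: mulr_natr.
pose c k := projT1 (cid (dualc k)).
have cP k : [/\ continuous (c k),
    forall g h, c k (g * h) = (c k g + th g * c k h)%R &
    forall i, padic_residue (c k (pi (x i))) = (padic_residue u *+ (i == k))%R].
  by rewrite /c; case: cid.
pose M : 'M[padic p]_d.+1 := (\matrix_(k, i) c k (pi (x i)))%R.
(* Cocycles for a fixed theta form a Z_p-module. Weighting them by the first row of the adjugate
   yields the first row of det(M) I on the basis, without inverting [M]. *)
exists (fun s => \sum_k (\adj M)%R ord0 k * c k (pi s))%R, (\det M)%R; split.
- apply: padic_continuous_sum => k; apply: padic_continuousM => //.
    by move=> s; exact: cvg_cst.
  have [ck _ _] := cP k.
  by move=> s; apply: continuous_comp; [exact: quotg_pi_continuous|exact: ck].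
- move=> g h; rewrite mulr_sumr -big_split /=; apply: eq_bigr => k _.
  by have [_ cM _] := cP k; rewrite /pi quotg_piM cM; ring.
- apply: (det_unit nu) => k i; have [_ _ c0] := cP k.
  by rewrite mxE c0 eq_sym.
- move=> i; have := congr1 (fun A : 'M_d.+1 => A ord0 i) (mul_adj_mx M).
  rewrite !mxE eq_sym => <-; apply: eq_bigr => k _; by rewrite [M k i]mxE.
move=> r Rr; apply: big1 => k _; have [_ cM _] := cP k.
have -> : pi r = 1.
  by apply/esym/quotg_piP; rewrite invg1 mul1g.
have -> : c k 1 = 0%R.
  by apply: (addrI (c k 1)); rewrite -{2}(mul1r (c k 1)) -(cyclo_theta1 th) -cM mulg1 addr0.
by rewrite mulr0.
Qed.

End DualCocycle.

Theorem theorem8p1 (p : nat) (p_prime : prime p) (d : nat)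
    (S : topGroupType) (x : 'I_d.+1 -> S) (S_free : free_pro_p p x)
    (R : set S) (R_normal : normal_subgroup R) (R_closed : closed R)
    (R_frattini : R `<=` frattini_p S p) :
  let S1 := closed_gen [set x i | i in [set i | i != ord0]] in
  (exists r : S, R r /\
    ((exists (l : padic p) (s : S),
        [/\ l <> 0%R, padic_ideal 1 l, S1 s & r = ppow (x ord0) l * s])
     \/
     (exists (k : nat) (l : padic p) (s t : S),
        [/\ (2 <= k)%N,
            padic_ideal 1 l /\ ~ padic_ideal k l,
            (S1 `&` derived_closed S) s,
            (lower_pcentral S p k.+1 `&` derived_closed S) t
          & r = ppow (x ord0) l * s * t]))) ->
  ~ exists theta : cyclotomic_pair p (quotg R_normal),
      torsion_free_pair theta /\ kummerian theta.
Proof.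
move=> S1 [r [Rr rcases]] [th [tf kum]].
have [c [D [cc cM D_unit cx cR]]] := dual_cocycle p_prime S_free R_frattini tf kum.
have [S_pro_p _ _] := S_free.
pose t s := th (quotg_pi R_normal s).
have t_cont : continuous t.
  by move=> s; apply: continuous_comp; [exact: quotg_pi_continuous|exact: cyclo_continuous].
have t1 : t 1 = 1%R by exact: cyclo_theta1.
have tM g h : t (g * h) = (t g * t h)%R by rewrite /t quotg_piM cyclo_thetaM.
have t_1p g : padic_ideal 1 (t g - 1)%R by exact: cyclo_1p.
have t_tf g n : (0 < n)%N -> (t g ^+ n = 1)%R -> t g = 1%R by exact: tf.
have cx0 : c (x ord0) = D by rewrite cx eqxx.
have cS1 s : S1 s -> c s = 0%R.
  move: s; apply: (cocycle_zero_closed_gen p_prime cc t1 cM) => _ [i /negbTE i0 <-].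
  by rewrite cx i0.
case: rcases => [[l [s [l0 _ Ss rE]]]|[k [l [s [v [k2 [_ nl] [Ss sd] [vk vd] rE]]]]]].
  (* [c] vanishes on S1, so [s] contributes nothing whatever theta does to x_1^l. *)
  have cy : c (ppow (x ord0) l) = 0%R.
    by have := cR r Rr; rewrite rE cM (cS1 s Ss) mulr0 addr0.
  have ty := cocycle_ppow_zero p_prime S_pro_p t_cont cc t1 tM cM cx0 D_unit cy.
  have tx := character_ppow_one p_prime S_pro_p t_cont t1 tM t_1p t_tf l0 ty.
  have := cocycle_ppow p_prime S_pro_p cc t1 cM l cx0 tx; rewrite cy => lD.
  apply: l0; apply: (pideal_sep p_prime) => n.
  by apply: (pideal_cancel_unit p_prime D_unit); rewrite mulrC -lD; exact: pideal_zero.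
have l0 : l <> 0%R by move=> l0; apply: nl; rewrite l0; exact: pideal_zero.
have ts := character_derived p_prime t_cont t1 tM sd.
have tv := character_derived p_prime t_cont t1 tM vd.
have ty : t (ppow (x ord0) l) = 1%R.
  have : t r = 1%R.
    rewrite /t; have -> : quotg_pi R_normal r = 1; last exact: cyclo_theta1.
    by apply/esym/quotg_piP; rewrite invg1 mul1g.
  by rewrite rE !tM ts tv !mulr1.
have tx := character_ppow_one p_prime S_pro_p t_cont t1 tM t_1p t_tf l0 ty.
have cy := cocycle_ppow p_prime S_pro_p cc t1 cM l cx0 tx.
have [_ cv] := cocycle_lower_pcentral p_prime t_cont cc t1 tM t_1p cM vk.
(* Here 0 = c(r) = l D + c(v) with c(v) in p^k Z_p, which puts [l] in p^k Z_p. *)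
apply: nl; apply: (pideal_cancel_unit p_prime D_unit).
have := cR r Rr; rewrite rE cM cM (cS1 s Ss) cy.
rewrite -/(t _) -/(t _) tM ty ts mulr0 addr0 !mul1r => /eqP.
by rewrite addr_eq0 mulrC => /eqP ->; exact: pidealN.
Qed.
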